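(* Let $B_2\subset B_1\subset B$ be a Banach triple with norms $\|\cdot\|_2,\|\cdot\|_1,\|\cdot\|$, and let $B^{par}$ be another Banach space with norm $\|\cdot\|_{par}$. Assume: (i) $D=(D_1,\dots,D_n)$ with $D_i\in\mathcal L(B_1,B)\cap\mathcal L(B_2,B_1)$, the norms of all $D_i$ being bounded by $1$ in both $\mathcal L(B_1,B)$ and $\mathcal L(B_2,B_1)$. (ii) $A\in\mathcal L(B_2,B)$ generates a strongly continuous semigroup $e^{At}$ in both $B$ and $B_1$, with $\|e^{At}\|_{B\to B}\le Me^{mt}$ and $\|e^{At}\|_{B_1\to B_1}\le M_1e^{m_1t}$ for some nonnegative constants $M,m,M_1,m_1$, and $B_2$ is an invariant core for this semigroup in $B$. (iii) $H:\mathbf R\times B\times B^n\times B^{par}\to B$ is a continuous mapping such that, with some constants $L_H,L'_H,L_H^{par}$ and for all arguments, $$\|H(t,b_0,b_1,\dots,b_n,\alpha)-H(t,\tilde b_0,\tilde b_1,\dots,\tilde b_n,\alpha)\|\le L_H\sum_{j=0}^n\|b_j-\tilde b_j\|\Big(1+L'_H\sum_{j=1}^n\|b_j\|\Big),$$ $$\|H(t,b_0,\dots,b_n,\alpha)-H(t,b_0,\dots,b_n,\tilde\alpha)\|\le L_H^{par}\|\alpha-\tilde\alpha\|_{par}\Big(1+\sum_{j=1}^n\|b_j\|\Big),$$ $$\|H(t,b_0,\dots,b_n,\alpha)\|\le L_H\sum_{j=1}^n\|b_j\|.$$ (iv) For $t>0$ the operator $e^{At}$ takes $B$ to $B_1$,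 and $\|e^{At}\|_{B\to B_1}\le\varkappa t^{-\omega}$ for $t\in(0,1]$, with some constants $\varkappa>0$ and $\omega\in(0,1)$. Let $a\in\mathbf R$. Then the equation $$b(t)=e^{A(t-a)}Y+\int_a^te^{A(t-s)}H(s,b(s),Db(s),\alpha)\,ds,\qquad t\ge a,$$ is well posed in $B_1$, that is, for any $Y\in B_1$, $\alpha\in B^{par}$ there exists its unique global solution $b(t)=b(t;Y,\alpha)\in B_1$ (continuous in $t\ge a$ with values in $B_1$), which depends Lipschitz continuously on the initial data $Y$ and the parameter $\alpha$. In particular, for every $T>a$, $$\sup_{t\in[a,T]}\|b(t;Y,\alpha)-b(t;\tilde Y,\tilde\alpha)\|_1\le K\big(\|\alpha-\tilde\alpha\|_{par}(1+\|Y\|_1)+\|Y-\tilde Y\|_1\big),$$ with a constant $K$ depending on $T-a$ and all constants entering the assumptions of the theorem.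
   Context: $\mathcal L(B,C)$ is the Banach space of bounded linear operators $B\to C$ with operator norm $\|\cdot\|_{B\to C}$. A Banach triple is a sequence of embedded Banach spaces $B_2\subset B_1\subset B$ with norms satisfying $\|\cdot\|_2\ge\|\cdot\|_1\ge\|\cdot\|$ (on the spaces where they are defined), such that $B_2$ is dense in $B_1$ in the topology of $B_1$ and $B_1$ is dense in $B$ in the topology of $B$. $Db=(D_1b,\dots,D_nb)$. The integral equation is the mild form of the Cauchy problem $\dot b(t)=Ab(t)+H(t,b(t),Db(t),\alpha)$, $b(a)=Y$, $t\ge a$.
   Formalization: The constant K also depends on L'_H·r for any bound r ≥ ‖Y‖_1, so it is uniform in Y only on balls when L'_H > 0; the claim with K independent of Y fails for H = b_1 sin b_1, A = 0 on R, and for L'_H = 0 it is as stated. *)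

(* Defs.v *)
(* Real analysis over Stdlib's R and Coquelicot; a real Banach space is a
   [CompleteNormedModule R_AbsRing].  From MathComp, only the finite ordinals
   'I_n and the big operators are used. *)
From Stdlib Require Export Reals.
From mathcomp Require Export ssreflect ssrfun ssrbool eqtype ssrnat fintype bigop.
From Coquelicot Require Export Coquelicot.

Open Scope R_scope.

Notation Banach := (CompleteNormedModule R_AbsRing).

Definition opnorm {U V : Banach} (f : U -> V) : Rbar :=
  Lub_Rbar (fun r => exists x : U, norm x <= 1 /\ r = norm (f x)).

(* f belongs to L(U,V), with ||f||_{U->V} <= c. *)
Definition bounded_op {U V : Banach} (f : U -> V) (c : R) : Prop :=
  is_linear f /\ Rbar_le (opnorm f) c.

(* An inclusion of Banach spaces is given by its injection j : U -> V. *)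
Record dense_embedding {U V : Banach} (j : U -> V) : Prop := {
  emb_linear : is_linear j;
  emb_inj : injective j;
  emb_norm : forall x : U, norm (j x) <= norm x;
  emb_dense : forall (y : V) (eps : R), 0 < eps ->
    exists x : U, norm (minus (j x) y) < eps
}.

Definition Banach_triple {B2 B1 B : Banach} (j2 : B2 -> B1) (j1 : B1 -> B) : Prop :=
  dense_embedding j2 /\ dense_embedding j1.

(* Only the values S t for t >= 0 matter. *)
Record C0_semigroup {X : Banach} (S : R -> X -> X) : Prop := {
  sg_linear : forall t, 0 <= t -> is_linear (S t);
  sg_zero : forall x, S 0 x = x;
  sg_add : forall s t, 0 <= s -> 0 <= t -> forall x, S (s + t) x = S s (S t x);
  sg_cont : forall x, filterlim (fun t => S t x) (at_right 0) (locally x)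
}.

(* x is in the domain of the generator of S, which maps it to y. *)
Definition is_generator {X : Banach} (S : R -> X -> X) (x y : X) : Prop :=
  filterlim (fun t => scal (/ t) (minus (S t x) x)) (at_right 0) (locally y).

(* The generator of S in X extends A, and the image of U is invariant under S
   and is a core: the generator is the closure of its restriction A. *)
Record invariant_core {U X : Banach} (j : U -> X) (A : U -> X) (S : R -> X -> X)
  : Prop := {
  core_generator : forall u : U, is_generator S (j u) (A u);
  core_invariant : forall t, 0 <= t -> forall u : U, exists v : U, S t (j u) = j v;
  core_closure : forall x y : X, is_generator S x y ->
    forall eps : R, 0 < eps -> exists u : U,
      norm (minus (j u) x) < eps /\ norm (minus (A u) y) < eps
}.

(* An operator between larger spaces that also maps the smaller ones to each
   other is represented on the smaller ones by its restriction D'. *)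
Definition assumption_D {B2 B1 B : Banach} (j2 : B2 -> B1) (j1 : B1 -> B)
    (n : nat) (D : 'I_n -> B1 -> B) : Prop :=
  forall i : 'I_n,
    bounded_op (D i) 1 /\
    exists D' : B2 -> B1, (forall x, j1 (D' x) = D i (j2 x)) /\ bounded_op D' 1.

(* S t stands for e^{At} on B, S1 t for its restriction to B1.  That A generates
   the restricted semigroup in B1 means that the generator of S1 agrees with A
   wherever A takes values in B1. *)
Definition assumption_A {B2 B1 B : Banach} (j2 : B2 -> B1) (j1 : B1 -> B)
    (A : B2 -> B) (S : R -> B -> B) (M m M1 m1 : R) : Prop :=
  is_linear A /\
  C0_semigroup S /\
  invariant_core (fun x => j1 (j2 x)) A S /\
  (forall t, 0 <= t -> Rbar_le (opnorm (S t)) (M * exp (m * t))) /\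
  exists S1 : R -> B1 -> B1,
    C0_semigroup S1 /\
    (forall t, 0 <= t -> forall x, j1 (S1 t x) = S t (j1 x)) /\
    (forall (x : B2) (y : B1), A x = j1 y -> is_generator S1 (j2 x) y) /\
    (forall t, 0 <= t -> Rbar_le (opnorm (S1 t)) (M1 * exp (m1 * t))).

Definition sum_norms {B : Banach} (n : nat) (b : 'I_n -> B) : R :=
  \big[Rplus/0]_(j < n) norm (b j).

(* The arguments b_0 and (b_1, ..., b_n) of H are separate.  As n is finite, the
   uniform structure of 'I_n -> B is that of the product B^n.
   If LH' > 0, H need not be globally Lipschitz in b, and the Lipschitz constant
   of the solution in Y is then uniform only over balls |Y| <= r of B1: in the
   case B2 = B1 = B = R, A = 0, D_1 = id, H = b_1 sin b_1 (LH = LH' = 1), the flow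
   of b' = b sin b over time t has derivative exp (2 pi k t) at Y = 2 pi k. *)
Definition assumption_H {B Bpar : Banach} (n : nat)
    (H : R -> B -> ('I_n -> B) -> Bpar -> B) (LH LH' LHpar : R) : Prop :=
  (forall p : R * B * ('I_n -> B) * Bpar,
    continuous (fun q : R * B * ('I_n -> B) * Bpar =>
      H (fst (fst (fst q))) (snd (fst (fst q))) (snd (fst q)) (snd q)) p) /\
  (forall t b0 c0 (b c : 'I_n -> B) alpha,
    norm (minus (H t b0 b alpha) (H t c0 c alpha)) <=
    LH * (norm (minus b0 c0) + sum_norms n (fun j => minus (b j) (c j)))
       * (1 + LH' * sum_norms n b)) /\
  (forall t b0 (b : 'I_n -> B) alpha alpha',
    norm (minus (H t b0 b alpha) (H t b0 b alpha')) <=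
    LHpar * norm (minus alpha alpha') * (1 + sum_norms n b)) /\
  (forall t b0 (b : 'I_n -> B) alpha,
    norm (H t b0 b alpha) <= LH * sum_norms n b).

Definition assumption_smoothing {B1 B : Banach} (j1 : B1 -> B)
    (S : R -> B -> B) (kappa omega : R) : Prop :=
  forall t, 0 < t ->
    exists St : B -> B1,
      (forall x, j1 (St x) = S t x) /\
      (t <= 1 -> Rbar_le (opnorm St) (kappa * Rpower t (- omega))).

(* The integral is a Riemann integral in B. *)
Definition mild_solution {B1 B Bpar : Banach} (j1 : B1 -> B) (n : nat)
    (D : 'I_n -> B1 -> B) (S : R -> B -> B)
    (H : R -> B -> ('I_n -> B) -> Bpar -> B)
    (a : R) (Y : B1) (alpha : Bpar) (b : R -> B1) : Prop :=
  continuous_on (fun t => a <= t) b /\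
  forall t, a <= t ->
    exists I : B,
      is_RInt (fun s => S (t - s) (H s (j1 (b s)) (fun i => D i (b s)) alpha)) a t I /\
      j1 (b t) = plus (S (t - a) (j1 Y)) I.

(* Main.v *)
(* For a continuous b, smoothing makes s |-> e^{A(t-s)} H(s, b(s), Db(s), alpha)
   a continuous B1-valued function on [a, t) of size O((t-s)^{-omega}), so the
   integral in the mild equation converges as an improper integral in B1.  In the
   weighted norm sup_t e^{-lam (t-a)} |b(t)|_1 on [a, a + tau] the convolution with
   e^{At} has norm eps, arbitrarily small for large lam.  A first weight, using only
   the linear growth of H, bounds b (and the Picard iterates) by a multiple of
   |Y|_1; on that ball the nonlinearity is Lipschitz, and a second, larger weight
   makes the Picard map a contraction with factor 1/2.  The same two estimates, in
   which only the bound of one of the two solutions enters, give the Lipschitz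
   dependence on Y and alpha, hence uniqueness. *)
From Stdlib Require Import Lra ClassicalEpsilon.
Require Import Defs.

(** * Normed spaces and Riemann integrals *)

(** The equation is an identity between Riemann integrals in [B], whereas the estimates live in
    [B1], where the integrand may blow up at the upper limit. The injection joins the two: the image
    of the [B1]-limit of the truncated integrals is the full integral in [B], and identities in [B1]
    are checked after applying the injection. The weights depend on the length of the time interval,
    but the Picard iterates do not. They therefore converge on all bounded intervals simultaneously,
    and no local solutions have to be glued. [K] is fixed before the spaces and the data, so both
    weights are chosen from scalars alone. The radius of the ball that holds a solution is a
    multiple of the norm of [Y], and it enters the Lipschitz constant of the nonlinearity only
    through its product with [LH']; this is the origin of the argument [LH' * r] of [K]. *)

Section NormedSpaces.

Context {V : NormedModule R_AbsRing}.

Lemma norm_minus_sym (x y : V) : norm (minus x y) = norm (minus y x).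
Proof. by rewrite -norm_opp opp_minus. Qed.

Lemma norm_minus_triangle (r x y : V) :
  norm (minus x y) <= norm (minus x r) + norm (minus r y).
Proof. by rewrite (minus_trans r x y); exact: norm_triangle. Qed.

Lemma minus_plus_plus (x y z w : V) :
  minus (plus x y) (plus z w) = plus (minus x z) (minus y w).
Proof.
rewrite /minus opp_plus -!plus_assoc; congr plus.
by rewrite plus_assoc (plus_comm y) -plus_assoc.
Qed.

Lemma norm_le_minus (x y : V) : norm x <= norm y + norm (minus x y).
Proof.
have -> : norm x = norm (plus y (minus x y)).
  by rewrite /minus plus_comm -plus_assoc plus_opp_l plus_zero_r.
exact: norm_triangle.
Qed.

Lemma eq_of_small_dist (x y : V) :
  (forall eps, 0 < eps -> norm (minus x y) <= eps) -> x = y.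
Proof.
move=> h; have e : norm (minus x y) = 0.
  apply: Rle_antisym; last exact: norm_ge_0.
  by apply: le_epsilon => eps he; rewrite Rplus_0_l; exact: h.
have {}e := norm_eq_zero _ e.
have : plus (minus x y) y = plus zero y by rewrite e.
by rewrite /minus -plus_assoc plus_opp_l plus_zero_r plus_zero_l.
Qed.

Lemma locally_R_eps (x : R) (P : R -> Prop) :
  locally x P <-> exists d, 0 < d /\ forall y, Rabs (y - x) < d -> P y.
Proof.
split=> [[d hd]|[d [d0 hd]]].
  by exists d; split; [exact: cond_pos|move=> y hy; apply: hd].
by exists (mkposreal d d0) => y hy; apply: hd.
Qed.

(** Uniform balls and norm balls agree only up to [norm_factor]. Rescaling [eps] by it once here
    keeps the factor out of all later estimates. *)
Lemma filterlim_norm_eps {T : Type} (F : (T -> Prop) -> Prop)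
    {FF : Filter F} (f : T -> V) (y : V) :
  filterlim f F (locally y) <->
  forall eps, 0 < eps -> F (fun t => norm (minus (f t) y) < eps).
Proof.
split=> [h eps he|h].
  have [nf [nf0 hnf]] : exists nf, 0 < nf /\ nf = @norm_factor _ V.
    by exists (@norm_factor _ V); split=> //; exact: norm_factor_gt_0.
  have he' : 0 < eps / nf by apply: Rdiv_lt_0_compat.
  have h1 := proj1 (@filterlim_locally _ _ F FF f y) h (mkposreal _ he').
  apply: (filter_imp _ _ _ h1) => t /norm_compat2 /=; rewrite -hnf.
  by have -> : nf * (eps / nf) = eps by field; lra.
apply/filterlim_locally => eps.
apply: (filter_imp _ _ _ (h eps (cond_pos eps))) => t; exact: norm_compat1.
Qed.

Lemma continuous_eps (f : R -> V) (x : R) :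
  continuous f x <->
  forall eps, 0 < eps -> exists d, 0 < d /\
    forall y, Rabs (y - x) < d -> norm (minus (f y) (f x)) < eps.
Proof.
rewrite /continuous filterlim_norm_eps.
split=> h eps he.
  exact: (proj1 (locally_R_eps _ _) (h eps he)).
exact: (proj2 (locally_R_eps _ _) (h eps he)).
Qed.

Lemma Rmax_contraction (a x y : R) : Rabs (Rmax a y - Rmax a x) <= Rabs (y - x).
Proof.
rewrite /Rmax /Rabs.
repeat match goal with
  | |- context [Rle_dec ?u ?v] => destruct (Rle_dec u v)
  | |- context [Rcase_abs ?u] => destruct (Rcase_abs u)
end; lra.
Qed.

(** Clamping time at [a] is 1-Lipschitz and lands in the half-line, so one-sided continuity at [a]
    becomes continuity on all of [R]. *)
Lemma continuous_on_extend (a : R) (b : R -> V) :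
  continuous_on (fun t => a <= t) b ->
  forall t, continuous (fun s => b (Rmax a s)) t.
Proof.
move=> h t; apply/continuous_eps => eps he.
have hm : a <= Rmax a t := Rmax_l a t.
pose proof (proj1 (filterlim_norm_eps _ _ _) (h _ hm) eps he) as h1.
have [d [d0 hd]] := proj1 (locally_R_eps _ _) h1.
exists d; split=> // y hy; apply: hd; last exact: Rmax_l.
by apply: Rle_lt_trans hy; exact: Rmax_contraction.
Qed.

End NormedSpaces.

(** Rescaling to the unit sphere. Only homogeneity is asked of [f], which the smoothing operators
    [St], not assumed linear, inherit through the injection. *)
Lemma opnorm_le {U V : Banach} (f : U -> V) (c : R) :
  (forall (k : R) x, f (scal k x) = scal k (f x)) ->
  Rbar_le (opnorm f) c -> forall x, norm (f x) <= c * norm x.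
Proof.
move=> hf hc x.
have hub y : norm y <= 1 -> norm (f y) <= c.
  move=> hy; have [h _] := Lub_Rbar_correct (fun r => exists x : U, norm x <= 1 /\ r = norm (f x)).
  have {}h : Rbar_le (norm (f y)) (opnorm f) by apply: h; exists y.
  exact: (Rbar_le_trans _ _ _ h hc).
case: (Rle_lt_or_eq_dec 0 (norm x) (norm_ge_0 x)) => [hx|hx].
  have hi : 0 < / norm x by apply: Rinv_0_lt_compat.
  have h : norm (f (scal (/ norm x) x)) <= c.
    apply: hub; apply: Rle_trans (norm_scal _ _) _.
    by rewrite /abs /= Rabs_pos_eq ?Rinv_l; lra.
  have -> : f x = scal (norm x) (f (scal (/ norm x) x)).
    rewrite -hf scal_assoc /mult /= Rinv_r; last lra.
    by have -> : scal 1 x = x := scal_one x.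
  apply: Rle_trans (norm_scal _ _) _.
  rewrite /abs /= Rabs_pos_eq; last lra.
  by rewrite Rmult_comm; apply: Rmult_le_compat_r; lra.
have hx0 : x = zero by apply: norm_eq_zero.
have -> : f x = zero.
  by rewrite hx0 -(scal_zero_l (zero : U)) hf scal_zero_l.
by rewrite -hx norm_zero; lra.
Qed.

Lemma is_RInt_linear {U V : NormedModule R_AbsRing} (l : U -> V) (f : R -> U) a b If :
  is_linear l -> is_RInt f a b If -> is_RInt (fun s => l (f s)) a b (l If).
Proof.
move=> hl hf; rewrite /is_RInt.
have hs ptd : Riemann_sum (fun s => l (f s)) ptd = l (Riemann_sum f ptd).
  apply: (SF_cons_ind (fun s => Riemann_sum (fun x => l (f x)) s = l (Riemann_sum f s))).
    move=> x0; rewrite /Riemann_sum /=; symmetry.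
    by rewrite -(scal_zero_l (zero : U)) (linear_scal _ hl) scal_zero_l.
  by move=> h s ih; rewrite !Riemann_sum_cons ih (linear_plus _ hl) (linear_scal _ hl).
apply: (filterlim_ext (fun ptd => l (scal (sign (b - a)) (Riemann_sum f ptd)))).
  by move=> ptd; rewrite hs (linear_scal _ hl).
apply: filterlim_comp hf _; exact: linear_cont.
Qed.

(** The difference splits into [W s (g s - g s0)], small by the local uniform bound, and
    [(W s - W s0) (g s0)], small by strong continuity. *)
Lemma continuous_apply_family {U V : NormedModule R_AbsRing} (W : R -> U -> V)
    (g : R -> U) (s0 K : R) :
  locally s0 (fun s => (forall x y, W s (minus x y) = minus (W s x) (W s y)) /\
                       forall x, norm (W s x) <= K * norm x) ->
  (forall x, continuous (fun s => W s x) s0) ->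
  continuous g s0 -> continuous (fun s => W s (g s)) s0.
Proof.
move=> hW hc hg; apply/filterlim_norm_eps => eps he.
have hK : 0 < 2 * (Rabs K + 1) by have := Rabs_pos K; lra.
have he' : 0 < eps / (2 * (Rabs K + 1)) by apply: Rdiv_lt_0_compat.
pose proof (proj1 (filterlim_norm_eps _ _ _) hg _ he') as h1.
have he2 : 0 < eps / 2 by lra.
pose proof (proj1 (filterlim_norm_eps _ _ _) (hc (g s0)) _ he2) as h2.
apply: (filter_imp _ _ _ (filter_and _ _ (filter_and _ _ hW h1) h2)).
move=> s [[[hl hb] h1s] h2s].
apply: Rle_lt_trans (norm_minus_triangle (W s (g s0)) _ _) _.
rewrite -hl; have := hb (minus (g s) (g s0)).
have : K * norm (minus (g s) (g s0)) <= (Rabs K + 1) * (eps / (2 * (Rabs K + 1))).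
  apply: Rle_trans (Rmult_le_compat_r _ K (Rabs K + 1) (norm_ge_0 _) _) _.
    by have := Rle_abs K; lra.
  by apply: Rmult_le_compat_l; have := Rabs_pos K; lra.
have -> : (Rabs K + 1) * (eps / (2 * (Rabs K + 1))) = eps / 2 by field; lra.
lra.
Qed.

(** * Weakly singular integrals *)

(* The integral of [s^-q] over [(0, z)] for [z > 0] and [q < 1]; at [z = 0] the value
   is the junk [/ (1 - q)], since [Rpower 0 _ = 1]. *)
Definition powint (q z : R) : R := Rpower z (1 - q) / (1 - q).

Lemma powint_gt0 (q z : R) : q < 1 -> 0 < powint q z.
Proof. by move=> hq; apply: Rdiv_lt_0_compat; [exact: exp_pos|lra]. Qed.

Lemma powint_le (q y z : R) : q < 1 -> 0 < y <= z -> powint q y <= powint q z.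
Proof.
move=> hq hyz; apply: Rmult_le_compat_r; first by left; apply: Rinv_0_lt_compat; lra.
by apply: Rle_Rpower_l; lra.
Qed.

Lemma powint_small (q C eps : R) : q < 1 -> 0 <= C -> 0 < eps ->
  exists d, 0 < d /\ C * powint q d < eps.
Proof.
move=> hq hC he.
(* Solves [powint q d = eps / (C + 1)] for [d]; the [+ 1] covers [C = 0]. *)
set e := eps * (1 - q) / (C + 1).
have he0 : 0 < e by rewrite /e; apply: Rdiv_lt_0_compat; [apply: Rmult_lt_0_compat; lra|lra].
exists (Rpower e (/ (1 - q))); split; first exact: exp_pos.
rewrite /powint Rpower_mult Rinv_l; last lra.
rewrite Rpower_1 // /e.
have -> : C * (eps * (1 - q) / (C + 1) / (1 - q)) = eps * (C / (C + 1)) by field; lra.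
rewrite -{2}(Rmult_1_r eps); apply: Rmult_lt_compat_l => //.
apply: (Rmult_lt_reg_r (C + 1)); first lra.
by have -> : C / (C + 1) * (C + 1) = C; [field; lra|lra].
Qed.

Lemma is_RInt_powint (q t c u : R) : q < 1 -> c <= u -> u < t ->
  is_RInt (fun s => Rpower (t - s) (- q)) c u (powint q (t - c) - powint q (t - u)).
Proof.
move=> hq hcu hut.
have -> : powint q (t - c) - powint q (t - u) =
          minus (- powint q (t - u)) (- powint q (t - c)).
  rewrite /minus /plus /opp /=; ring.
have hmx s : Rmin c u <= s <= Rmax c u -> 0 < t - s.
  by rewrite Rmax_right //; lra.
apply: (is_RInt_derive (fun s => - powint q (t - s))) => s /hmx hs.
  rewrite /powint /Rpower; auto_derive; first lra.
  have -> : - q * ln (t - s) = (1 - q) * ln (t - s) + - ln (t - s) by ring.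
  rewrite exp_plus exp_Ropp exp_ln //; rewrite /Rminus; field; lra.
apply: ex_derive_continuous; rewrite /Rpower; auto_derive; lra.
Qed.

Section SingularIntegral.

Context {V : Banach} (f : R -> V) (q C c t : R).
Hypothesis hq : q < 1.
Hypothesis hC : 0 <= C.
Hypothesis hct : c < t.
Hypothesis hbound : forall s, c <= s < t -> norm (f s) <= C * Rpower (t - s) (- q).

(** The positive term [powint q (t - v)] is dropped, which makes the bound uniform in [v] up to the
    singularity. *)
Lemma norm_RInt_singular (u v : R) (J : V) : c <= u -> u <= v -> v < t ->
  is_RInt f u v J -> norm J <= C * powint q (t - u).
Proof.
move=> hcu huv hvt hJ.
have h := is_RInt_scal _ _ _ C _ (is_RInt_powint q t u v hq huv hvt).
apply: Rle_trans (norm_RInt_le _ _ u v _ _ huv _ hJ h) _.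
  by move=> s hs; apply: hbound; lra.
apply: Rmult_le_compat_l => //.
by have := powint_gt0 q (t - v) hq; lra.
Qed.

(** Cauchy criterion: two truncations ending within [d] of [t] differ by at most [C * powint q d],
    which tends to 0 with [d]. *)
Lemma ex_improper_RInt :
  (forall s, s < t -> continuous f s) ->
  exists J, filterlim (fun u => RInt f c u) (at_left t) (locally J) /\
            norm J <= C * powint q (t - c).
Proof.
move=> hf.
have hex u v : u < t -> v < t -> is_RInt f u v (RInt f u v).
  move=> hu hv; apply: RInt_correct; apply: ex_RInt_continuous => z hz; apply: hf.
  by apply: Rle_lt_trans (proj2 hz) _; apply: Rmax_lub_lt.
have hdist u v d : 0 < d -> c <= u -> t - d < u -> u <= v -> v < t ->
    norm (minus (RInt f c v) (RInt f c u)) <= C * powint q d.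
  move=> hd hcu hu huv hv.
  have e : RInt f c v = plus (RInt f c u) (RInt f u v).
    by apply: is_RInt_unique; apply: is_RInt_Chasles; apply: hex; lra.
  rewrite e /minus (plus_comm (RInt f c u)) -plus_assoc plus_opp_r plus_zero_r.
  apply: Rle_trans (norm_RInt_singular _ _ _ hcu huv hv (hex _ _ _ hv)) _; first lra.
  by apply: Rmult_le_compat_l => //; apply: powint_le => //; lra.
have [J hJ] : exists J, filterlim (fun u => RInt f c u) (at_left t) (locally J).
  apply/filterlim_locally_cauchy => eps.
  have [d [hd hde]] := powint_small q C eps hq hC (cond_pos eps).
  have hd' : 0 < Rmin d (t - c) by apply: Rmin_glb_lt; lra.
  have m1 := Rmin_l d (t - c); have m2 := Rmin_r d (t - c).
  exists (fun u => t - Rmin d (t - c) < u < t); split.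
    exists (mkposreal _ hd') => y hy hyt; split=> //.
    by move/Rabs_def2: hy => /= [_]; rewrite /minus /plus /opp /=; lra.
  move=> u v hu hv; apply: norm_compat1; case: (Rle_dec u v) => huv.
    by apply: Rle_lt_trans hde; apply: hdist; lra.
  by rewrite norm_minus_sym; apply: Rle_lt_trans hde; apply: hdist; lra.
exists J; split=> //; apply: le_epsilon => eps he.
pose proof (proj1 (filterlim_norm_eps _ _ _) hJ _ he) as h.
have hloc : at_left t (fun u => c <= u < t).
  have hd : 0 < t - c by lra.
  exists (mkposreal _ hd) => y hy hyt; split=> //.
  by move/Rabs_def2: hy => /= [_]; rewrite /minus /plus /opp /=; lra.
have [u [hu1 hu2]] := filter_ex _ (filter_and _ _ h hloc).
apply: Rle_trans (norm_le_minus J (RInt f c u)) _.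
rewrite norm_minus_sym in hu1.
have : norm (RInt f c u) <= C * powint q (t - c).
  by apply: (norm_RInt_singular c u); try lra; apply: hex; lra.
lra.
Qed.

End SingularIntegral.

(** * Semigroups, weights and limits *)

Lemma exp_le_mono (x y : R) : x <= y -> exp x <= exp y.
Proof. by case=> [h|->]; [left; exact: exp_increasing|right]. Qed.

Lemma mult_exp_ge0 (c x : R) : 0 <= c -> 0 <= c * exp x.
Proof. by move=> hc; apply: Rmult_le_pos => //; left; exact: exp_pos. Qed.

Lemma Rpower_neg_le (p y z : R) : 0 <= p -> 0 < y <= z -> Rpower z (- p) <= Rpower y (- p).
Proof.
move=> hp hyz; rewrite /Rpower; apply: exp_le_mono.
have : ln y <= ln z by apply: ln_le; lra.
nra.
Qed.

(** For [p < q] the increment of the orbit is [S p] applied to [S (q - p) x - x]. Right continuity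
    at 0 and a bound on [S p] for bounded [p] thus give continuity from both sides. *)
Lemma semigroup_continuous {X : Banach} (S : R -> X -> X) (M m : R) :
  0 <= M -> 0 <= m -> C0_semigroup S ->
  (forall t, 0 <= t -> forall x, norm (S t x) <= M * exp (m * t) * norm x) ->
  forall x t, continuous (fun s => S (Rmax 0 s) x) t.
Proof.
move=> hM hm hS hb x t; apply/continuous_eps => eps he.
set t' := Rmax 0 t; have ht' : 0 <= t' := Rmax_l 0 t.
set K := M * exp (m * (t' + 1)) + 1.
have hK : 0 < K by have := exp_pos (m * (t' + 1)); rewrite /K; nra.
have he' : 0 < eps / K by apply: Rdiv_lt_0_compat.
pose proof (proj1 (filterlim_norm_eps _ _ _) (sg_cont _ hS x) _ he') as h1.
have [d [d0 hd]] := proj1 (locally_R_eps _ _) h1.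
have key p q : 0 <= p -> p < q -> q - p < d -> p <= t' + 1 ->
    norm (minus (S q x) (S p x)) < eps.
  move=> hp hpq hqp hpt.
  have -> : q = p + (q - p) by ring.
  rewrite (sg_add _ hS) //; last lra.
  rewrite -(linear_minus _ _ _ (sg_linear _ hS p hp)).
  apply: Rle_lt_trans (hb _ hp _) _.
  have hqd : norm (minus (S (q - p) x) x) < eps / K.
    by apply: hd; [rewrite Rminus_0_r Rabs_pos_eq; lra|lra].
  have hMK : M * exp (m * p) < K.
    have : exp (m * p) <= exp (m * (t' + 1)) by apply: exp_le_mono; nra.
    by rewrite /K; nra.
  apply: (Rle_lt_trans _ (M * exp (m * p) * (eps / K))).
    by apply: Rmult_le_compat_l; [exact: mult_exp_ge0|left].
  have -> : eps = K * (eps / K) by field; lra.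
  have -> : K * (eps / K) / K = eps / K by field; lra.
  exact: Rmult_lt_compat_r.
exists (Rmin d 1); split; first by apply: Rmin_glb_lt; lra.
move=> s hs.
have := Rmax_contraction 0 t s; rewrite -/t' => hst.
have m1 := Rmin_l d 1; have m2 := Rmin_r d 1.
have {}hst : Rabs (Rmax 0 s - t') < Rmin d 1 by lra.
have hs' := Rmax_l 0 s.
move/Rabs_def2: hst => [hst1 hst2].
case: (Rtotal_order (Rmax 0 s) t') => [h|[->|h]].
- by rewrite norm_minus_sym; apply: key; lra.
- by rewrite minus_eq_zero norm_zero.
- by apply: key; lra.
Qed.

(** Replaces [kappa] when the smoothing bound is extended from times in (0, 1] to (0, tau]: for
    [t > 1] smooth during time 1, follow the semigroup of the smaller space for time [t - 1], and
    use that [tau^omega * t^(-omega)] is at least 1. *)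
Definition smoothing_const (M1 m1 kappa omega tau : R) : R :=
  kappa * (1 + M1 * exp (m1 * tau) * Rpower tau omega).

Lemma smoothing_const_gt0 (M1 m1 kappa omega tau : R) : 0 <= M1 -> 0 < kappa ->
  0 < smoothing_const M1 m1 kappa omega tau.
Proof.
move=> hM hk; apply: Rmult_lt_0_compat => //.
have := exp_pos (m1 * tau); have : 0 < Rpower tau omega := exp_pos _.
move=> h1 h2; have := Rmult_le_pos _ _ (Rmult_le_pos _ _ hM (Rlt_le _ _ h2)) (Rlt_le _ _ h1).
lra.
Qed.

(** The inequality [x^p <= exp x] in logarithmic form. *)
Lemma Rpower_le_exp (p x : R) : 0 <= p <= 1 -> 0 < x -> p * ln x <= x.
Proof.
move=> hp hx.
have hln : 1 + ln x <= x by rewrite -{2}(exp_ln x hx); exact: exp_ineq1_le.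
nra.
Qed.

(* [lam] makes the exponentially weighted kernel [k s^-omega exp (- lam s)] small
   in L^1(0, tau), through an integrable power majorant. *)
Definition weight_controls (k omega tau eps lam : R) : Prop :=
  0 < lam /\ exists q C, q < 1 /\ 0 <= C /\ C * powint q tau <= eps /\
  forall s, 0 < s -> k * Rpower s (- omega) * exp (- lam * s) <= C * Rpower s (- q).

(** Half of the spare exponent [1 - omega] is traded for decay in [lam]: since
    [(lam s)^p <= exp (lam s)], the weighted kernel is at most [k lam^(-p) s^(-omega - p)], still
    integrable. The chosen [lam] makes the integral of this majorant over (0, tau) equal to
    [eps]. *)
Lemma ex_weight (k omega tau eps : R) : 0 < k -> 0 < omega < 1 -> 0 < eps ->
  exists lam, weight_controls k omega tau eps lam.
Proof.
move=> hk ho he.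
set p := (1 - omega) / 2; set q := omega + p.
have hp : 0 < p by rewrite /p; lra.
have hq : q < 1 by rewrite /q /p; lra.
have hP := powint_gt0 q tau hq.
have hz : 0 < k * powint q tau / eps.
  by apply: Rdiv_lt_0_compat => //; apply: Rmult_lt_0_compat.
set lam := Rpower (k * powint q tau / eps) (/ p).
have hlam : 0 < lam by exact: exp_pos.
have elam : Rpower lam (- p) = eps / (k * powint q tau).
  rewrite /lam Rpower_mult.
  have -> : / p * - p = - (1) by field; lra.
  by rewrite Rpower_Ropp Rpower_1 //; field; lra.
exists lam; split=> //; exists q, (k * Rpower lam (- p)); split=> //; split.
  by left; apply: Rmult_lt_0_compat => //; exact: exp_pos.
split; first by rewrite elam; right; field; lra.
move=> s hs; rewrite !Rmult_assoc; apply: Rmult_le_compat_l; first lra.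
rewrite /Rpower -!exp_plus; apply: exp_le_mono.
have hls : 0 < lam * s by apply: Rmult_lt_0_compat.
have hp1 : 0 <= p <= 1 by rewrite /p; lra.
have := Rpower_le_exp p (lam * s) hp1 hls; rewrite ln_mult // /q; lra.
Qed.

(** Continuity makes the weighted supremum a finite, attained value [u sm]. Taking it as [G] gives
    [u sm <= C + u sm / 2], and the half is absorbed. *)
Lemma weighted_gronwall {X : NormedModule R_AbsRing} (b : R -> X) (a T lam C : R) :
  a <= T -> (forall t, continuous b t) ->
  (forall G, 0 <= G ->
     (forall s, a <= s <= T -> norm (b s) <= G * exp (lam * (s - a))) ->
     forall s, a <= s <= T -> norm (b s) <= (C + G / 2) * exp (lam * (s - a))) ->
  forall s, a <= s <= T -> norm (b s) <= 2 * C * exp (lam * (s - a)).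
Proof.
move=> haT hb hstep.
pose u s := norm (b s) * exp (- (lam * (s - a))).
have hue s : norm (b s) = u s * exp (lam * (s - a)).
  by rewrite /u Rmult_assoc -exp_plus Rplus_opp_l exp_0 Rmult_1_r.
have hu s : continuity_pt u s.
  apply/continuity_pt_filterlim.
  apply: (continuous_mult (fun s => norm (b s)) (fun s => exp (- (lam * (s - a))))).
    by apply: (continuous_comp b norm); [exact: hb|exact: filterlim_norm].
  by apply: (ex_derive_continuous (fun s => exp (- (lam * (s - a))))); auto_derive.
have [sm [hmax hsm]] := continuity_ab_maj u a T haT (fun s _ => hu s).
have hu0 : 0 <= u sm by apply: Rmult_le_pos; [exact: norm_ge_0|left; exact: exp_pos].
have h := hstep (u sm) hu0 _ sm hsm.
have {}h : u sm <= C + u sm / 2.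
  apply: (Rmult_le_reg_r (exp (lam * (sm - a)))); first exact: exp_pos.
  rewrite -hue; apply: h => s hs; rewrite hue.
  by apply: Rmult_le_compat_r; [left; exact: exp_pos|exact: hmax].
move=> s hs; rewrite hue; apply: Rmult_le_compat_r; first by left; exact: exp_pos.
by have := hmax s hs; lra.
Qed.

(** Supplies the kernel size [eps] for a nonlinearity of constant [z]; the [+ 1] keeps it finite at
    [z = 0]. *)
Lemma half_inv (z : R) : 0 <= z -> 0 < / (2 * (z + 1)) /\ / (2 * (z + 1)) * z <= / 2.
Proof.
move=> hz; have h : 0 < / (2 * (z + 1)) by apply: Rinv_0_lt_compat; lra.
split=> //; have e : / (2 * (z + 1)) * (z + 1) = / 2 by field; lra.
lra.
Qed.

Lemma half_pow_small (E eps : R) : 0 <= E -> 0 < eps ->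
  exists N, forall n, le N n -> E * (/ 2) ^ n < eps.
Proof.
move=> hE he.
have he' : 0 < eps / (E + 1) by apply: Rdiv_lt_0_compat; lra.
have habs : Rabs (/ 2) < 1 by rewrite Rabs_pos_eq; lra.
have [N hN] := pow_lt_1_zero _ habs _ he'.
exists N => n /hN; rewrite Rabs_pos_eq; last by apply: pow_le; lra.
move=> h; apply: (Rle_lt_trans _ ((E + 1) * (/ 2) ^ n)).
  by apply: Rmult_le_compat_r; [apply: pow_le; lra|lra].
have -> : eps = (E + 1) * (eps / (E + 1)) by field; lra.
by apply: Rmult_lt_compat_l => //; lra.
Qed.

(** The constant [E] may grow with [T], yet the pointwise limit is one curve on the whole half-line;
    continuity at a point only needs the rate on one interval reaching beyond it. *)
Lemma geometric_limit {X : Banach} (a : R) (b : nat -> R -> X) :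
  (forall k t, continuous (b k) t) ->
  (forall T, a < T -> exists E, 0 <= E /\ forall k t, a <= t <= T ->
     norm (minus (b (S k) t) (b k t)) <= E * (/ 2) ^ k) ->
  exists beta : R -> X, (forall t, continuous beta t) /\
  forall T, a < T -> exists E, 0 <= E /\ forall k t, a <= t <= T ->
      norm (minus (b k t) (beta t)) <= E * (/ 2) ^ k.
Proof.
move=> hb hE.
have hp k : 0 < (/ 2) ^ k by apply: pow_lt; lra.
(* The geometric sum is kept in exact closed form so that the induction on [i] closes. *)
have htel T E : (forall k t, a <= t <= T -> norm (minus (b (S k) t) (b k t)) <= E * (/ 2) ^ k) ->
    forall k i t, a <= t <= T ->
      norm (minus (b (Nat.add k i) t) (b k t)) <= 2 * E * ((/ 2) ^ k - (/ 2) ^ (Nat.add k i)).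
  move=> h k i t ht; elim: i => [|i ih].
    by rewrite Nat.add_0_r minus_eq_zero norm_zero; lra.
  rewrite Nat.add_succ_r.
  apply: Rle_trans (norm_minus_triangle (b (Nat.add k i) t) _ _) _.
  apply: Rle_trans (Rplus_le_compat _ _ _ _ (h (Nat.add k i) t ht) ih) _.
  by rewrite /=; lra.
have htel2 T E : 0 <= E ->
    (forall k t, a <= t <= T -> norm (minus (b (S k) t) (b k t)) <= E * (/ 2) ^ k) ->
    forall k l t, le k l -> a <= t <= T ->
      norm (minus (b l t) (b k t)) <= 2 * E * (/ 2) ^ k.
  move=> hE0 h k l t hkl ht.
  have -> : l = Nat.add k (Nat.sub l k) by rewrite Nat.add_comm Nat.sub_add.
  apply: Rle_trans (htel T E h k _ t ht) _.
  by apply: Rmult_le_compat_l; [lra|have := hp (Nat.add k (Nat.sub l k)); lra].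
have hlim t : a <= t -> exists y, filterlim (fun k => b k t) eventually (locally y).
  move=> ht; apply/filterlim_locally_cauchy => eps.
  have hT : a < t + 1 by lra.
  have [E [hE0 h]] := hE _ hT.
  have hE4 : 0 <= 4 * E by lra.
  have [N hN] := half_pow_small (4 * E) eps hE4 (cond_pos eps).
  exists (fun k => le N k); split; first by exists N.
  have hr : a <= t <= t + 1 by lra.
  move=> k l hk hl; apply: norm_compat1.
  apply: Rle_lt_trans (norm_minus_triangle (b N t) _ _) _.
  have h1 := htel2 _ E hE0 h N l t hl hr.
  have h2 := htel2 _ E hE0 h N k t hk hr; rewrite norm_minus_sym in h2.
  apply: Rle_lt_trans (Rplus_le_compat _ _ _ _ h1 h2) _.
  by have := hN N (le_n N); lra.
pose L t := epsilon (inhabits (zero : X)) (fun y : X => filterlim (fun k => b k t) eventually (locally y)).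
have hL t : a <= t -> filterlim (fun k => b k t) eventually (locally (L t)).
  by move=> ht; apply: (epsilon_spec (inhabits (zero : X))
    (fun y : X => filterlim (fun k => b k t) eventually (locally y))); exact: hlim.
have hrate T : a < T -> exists E, 0 <= E /\ forall k t, a <= t <= T ->
    norm (minus (b k t) (L t)) <= E * (/ 2) ^ k.
  move=> hT; have [E [hE0 h]] := hE _ hT.
  exists (2 * E); split; first lra.
  move=> k t ht; apply: le_epsilon => eps he.
  pose proof (proj1 (filterlim_norm_eps _ _ _) (hL t (proj1 ht)) _ he) as [N hN].
  have h1 := htel2 _ E hE0 h k (Nat.max k N) t (Nat.le_max_l _ _) ht.
  rewrite norm_minus_sym in h1.
  have h2 := hN _ (Nat.le_max_r k N).
  apply: Rle_trans (norm_minus_triangle (b (Nat.max k N) t) _ _) _.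
  by apply: Rplus_le_compat h1 _; left.
(* Nothing is known about convergence before [a], so the limit is frozen there at its value at
   [a]. *)
exists (fun t => L (Rmax a t)); split; last first.
  move=> T hT; have [E [hE0 h]] := hrate _ hT; exists E; split=> // k t ht.
  by rewrite Rmax_right; [exact: h|lra].
move=> t; apply/continuous_eps => eps he.
have hT : a < Rmax a t + 1 by have := Rmax_l a t; lra.
have [E [hE0 h]] := hrate _ hT.
have he3 : 0 < eps / 3 by lra.
have [N hN] := half_pow_small E _ hE0 he3.
have h0 := hN N (le_n N).
have [d [d0 hd]] := proj1 (continuous_eps _ _) (hb N (Rmax a t)) _ he3.
exists (Rmin d 1); split; first by apply: Rmin_glb_lt; lra.
move=> s hs; have l1 := Rmin_l d 1; have l2 := Rmin_r d 1.
have hs' := Rle_lt_trans _ _ _ (Rmax_contraction a t s) hs.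
have h1 := hd (Rmax a s) (Rlt_le_trans _ _ _ hs' l1).
move/Rabs_def2: hs' => hs'.
have hat := Rmax_l a t; have has := Rmax_l a s.
have h2 : norm (minus (b N (Rmax a s)) (L (Rmax a s))) < eps / 3.
  by apply: Rle_lt_trans h0; apply: h; lra.
have h3 : norm (minus (b N (Rmax a t)) (L (Rmax a t))) < eps / 3.
  by apply: Rle_lt_trans h0; apply: h; lra.
rewrite norm_minus_sym in h2.
apply: Rle_lt_trans (norm_minus_triangle (b N (Rmax a s)) _ _) _.
have h4 := Rle_lt_trans _ _ _ (norm_minus_triangle (b N (Rmax a t)) (b N (Rmax a s)) (L (Rmax a t)))
  (Rplus_lt_compat _ _ _ _ h1 h3).
apply: Rlt_le_trans (Rplus_lt_compat _ _ _ _ h2 h4) _; lra.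
Qed.

(** * Convolution with a smoothing semigroup *)

Section Convolution.

Context {X Y : Banach} (j : X -> Y) (S : R -> Y -> Y) (S1 : R -> X -> X).
Context (M m M1 m1 kappa omega : R).
Hypothesis hM : 0 <= M.
Hypothesis hm : 0 <= m.
Hypothesis hM1 : 0 <= M1.
Hypothesis hm1 : 0 <= m1.
Hypothesis hkappa : 0 < kappa.
Hypothesis homega : 0 < omega < 1.
Hypothesis j_linear : is_linear j.
Hypothesis j_inj : injective j.
Hypothesis j_norm : forall x, norm (j x) <= norm x.
Hypothesis S_semigroup : C0_semigroup S.
Hypothesis S1_semigroup : C0_semigroup S1.
Hypothesis S_restrict : forall t, 0 <= t -> forall x, j (S1 t x) = S t (j x).
Hypothesis S_bound :
  forall t, 0 <= t -> forall x, norm (S t x) <= M * exp (m * t) * norm x.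
Hypothesis S1_bound :
  forall t, 0 <= t -> forall x, norm (S1 t x) <= M1 * exp (m1 * t) * norm x.
Hypothesis smoothing : forall t, 0 < t ->
  exists St : Y -> X, (forall x, j (St x) = S t x) /\
    (t <= 1 -> forall x, norm (St x) <= kappa * Rpower t (- omega) * norm x).

Let kap := smoothing_const M1 m1 kappa omega.

(* [e^{At}] as an operator [Y -> X]; arbitrary for [t <= 0]. *)
Definition smooth (t : R) (y : Y) : X :=
  epsilon (inhabits zero) (fun x => j x = S t y).

Lemma smoothE (t : R) (y : Y) : 0 < t -> j (smooth t y) = S t y.
Proof.
move=> ht; have [St [h _]] := smoothing t ht.
by apply: (epsilon_spec (inhabits zero) (fun x => j x = S t y)); exists (St y).
Qed.

(** [smooth] is chosen vector by vector; its algebraic properties are those of [S t], pulled back by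
    injectivity of [j]. *)
Lemma smooth_minus (t : R) (y z : Y) : 0 < t ->
  smooth t (minus y z) = minus (smooth t y) (smooth t z).
Proof.
move=> ht; apply: j_inj.
rewrite (linear_minus _ _ _ j_linear) !smoothE //.
by apply: linear_minus; apply: sg_linear => //; lra.
Qed.

Lemma smooth_semigroup (s t : R) (y : Y) : 0 < t -> 0 <= s ->
  smooth (s + t) y = S1 s (smooth t y).
Proof.
move=> ht hs; apply: j_inj; rewrite S_restrict // !smoothE //; last lra.
by rewrite sg_add //; lra.
Qed.

Lemma smooth_bound (tau t : R) (y : Y) : 0 < t <= tau ->
  norm (smooth t y) <= kap tau * Rpower t (- omega) * norm y.
Proof.
move=> ht.
have hsmall u : 0 < u <= 1 -> norm (smooth u y) <= kappa * Rpower u (- omega) * norm y.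
  move=> hu; have [St [h1 h2]] := smoothing u (proj1 hu).
  have -> : smooth u y = St y by apply: j_inj; rewrite h1 smoothE //; lra.
  by apply: h2; lra.
have hR z w : 0 < Rpower z w := exp_pos _.
have hy := norm_ge_0 y.
case: (Rle_dec t 1) => ht1.
  apply: Rle_trans (hsmall _ _) _; first lra.
  apply: Rmult_le_compat_r => //; apply: Rmult_le_compat_r; first by left.
  rewrite /kap /smoothing_const.
  have : 0 <= M1 * exp (m1 * tau) * Rpower tau omega.
    by apply: Rmult_le_pos; [apply: Rmult_le_pos => //; left; exact: exp_pos|left].
  by nra.
have -> : t = (t - 1) + 1 by ring.
rewrite smooth_semigroup; try lra.
have -> : t - 1 + 1 = t by ring.
have ht0 : 0 <= t - 1 by lra.
apply: Rle_trans (S1_bound _ ht0 _) _.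
have h1 : norm (smooth 1 y) <= kappa * norm y.
  apply: Rle_trans (hsmall 1 _) _; first lra.
  have -> : Rpower 1 (- omega) = 1 by rewrite /Rpower ln_1 Rmult_0_r exp_0.
  lra.
apply: (Rle_trans _ (M1 * exp (m1 * tau) * (kappa * norm y))).
  apply: Rmult_le_compat => //.
  - by apply: Rmult_le_pos => //; left; exact: exp_pos.
  - exact: norm_ge_0.
  - by apply: Rmult_le_compat_l => //; apply: exp_le_mono; nra.
have h2 : 1 <= Rpower tau omega * Rpower t (- omega).
  have -> : 1 = Rpower t omega * Rpower t (- omega).
    by rewrite -Rpower_plus Rplus_opp_r Rpower_O //; lra.
  by apply: Rmult_le_compat_r; [left|apply: Rle_Rpower_l; lra].
have h3 : 0 <= M1 * exp (m1 * tau) by apply: Rmult_le_pos => //; left; exact: exp_pos.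
rewrite /kap /smoothing_const.
have h4 : 0 <= kappa * norm y by apply: Rmult_le_pos => //; lra.
have -> : kappa * (1 + M1 * exp (m1 * tau) * Rpower tau omega) * Rpower t (- omega) * norm y
  = kappa * norm y * (Rpower t (- omega) + M1 * exp (m1 * tau) * (Rpower tau omega * Rpower t (- omega))) by ring.
rewrite Rmult_comm; apply: Rmult_le_compat_l => //.
have := hR t (- omega); nra.
Qed.

(** Near [t] the curve is the [S1]-orbit of the point [smooth (t / 2) y] of [X]. *)
Lemma smooth_continuous (t : R) (y : Y) : 0 < t -> continuous (fun s => smooth s y) t.
Proof.
move=> ht.
apply: (continuous_ext_loc _ (fun s => S1 (Rmax 0 (s - t / 2)) (smooth (t / 2) y))).
  apply/locally_R_eps; exists (t / 2); split=> [|s /Rabs_def2 hs]; first lra.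
  rewrite Rmax_right; last lra.
  by rewrite -smooth_semigroup; try lra; congr smooth; lra.
apply: (continuous_comp (fun s => s - t / 2)
         (fun s => S1 (Rmax 0 s) (smooth (t / 2) y))).
  by apply: (ex_derive_continuous (fun s => s - t / 2)); auto_derive.
exact: (semigroup_continuous S1 M1 m1).
Qed.

(** For [u] near [s] the time [t - u] stays above [(t - s) / 2], so the operators are uniformly
    bounded there despite the singularity at 0. *)
Lemma smooth_apply_continuous (g : R -> Y) (t s : R) : s < t -> continuous g s ->
  continuous (fun u => smooth (t - u) (g u)) s.
Proof.
move=> hst hg.
apply: (continuous_apply_family (fun u => smooth (t - u)) g s
         (kap (2 * (t - s)) * Rpower ((t - s) / 2) (- omega))) => //.
  apply/locally_R_eps; exists ((t - s) / 2); split=> [|u /Rabs_def2 hu]; first lra.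
  split=> [y z|y]; first by apply: smooth_minus; lra.
  have hu2 : 0 < t - u <= 2 * (t - s) by lra.
  apply: Rle_trans (smooth_bound _ _ y hu2) _.
  apply: Rmult_le_compat_r; first exact: norm_ge_0.
  apply: Rmult_le_compat_l; first by left; exact: smoothing_const_gt0.
  by apply: Rpower_neg_le; lra.
move=> y; apply: (continuous_comp (fun u => t - u) (fun u => smooth u y)).
  by apply: (ex_derive_continuous (fun u => t - u)); auto_derive.
by apply: smooth_continuous; lra.
Qed.

Lemma semigroup_apply_continuous (g : R -> Y) (t s : R) : continuous g s ->
  continuous (fun u => S (Rmax 0 (t - u)) (g u)) s.
Proof.
move=> hg.
apply: (continuous_apply_family (fun u => S (Rmax 0 (t - u))) g s
         (M * exp (m * (Rmax 0 (t - s) + 1)))) => //.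
  apply/locally_R_eps; exists 1; split=> [|u hu]; first lra.
  have h0 := Rmax_l 0 (t - u).
  split=> [y z|y]; first by apply: linear_minus; exact: sg_linear.
  apply: Rle_trans (S_bound _ h0 y) _.
  apply: Rmult_le_compat_r; first exact: norm_ge_0.
  apply: Rmult_le_compat_l => //; apply: exp_le_mono; apply: Rmult_le_compat_l => //.
  have := Rmax_contraction 0 (t - s) (t - u).
  have -> : t - u - (t - s) = - (u - s) by ring.
  by rewrite Rabs_Ropp => h; have := Rle_abs (Rmax 0 (t - u) - Rmax 0 (t - s)); lra.
move=> y; apply: (continuous_comp (fun u => t - u) (fun u => S (Rmax 0 u) y)).
  by apply: (ex_derive_continuous (fun u => t - u)); auto_derive.
exact: (semigroup_continuous S M m).
Qed.

(** An element of [X] is specified through an integral in [Y]: the [X]-valued integrand may be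
    unbounded near [t], and the mild equation itself is stated with the integral in [Y]. *)
Definition is_conv (c t : R) (g : R -> Y) (J : X) : Prop :=
  is_RInt (fun s => S (t - s) (g s)) c t (j J).

Lemma is_conv_unique (c t : R) (g : R -> Y) (J J' : X) :
  is_conv c t g J -> is_conv c t g J' -> J = J'.
Proof.
by move=> h h'; apply: j_inj; rewrite -(is_RInt_unique _ _ _ _ h) (is_RInt_unique _ _ _ _ h').
Qed.

Lemma j_zero : j zero = zero.
Proof. by rewrite -(scal_zero_l (zero : X)) (linear_scal _ j_linear) scal_zero_l. Qed.

Lemma is_conv_minus (c t : R) (g g' : R -> Y) (J J' : X) : c <= t ->
  is_conv c t g J -> is_conv c t g' J' ->
  is_conv c t (fun s => minus (g s) (g' s)) (minus J J').
Proof.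
move=> hct h h'; rewrite /is_conv (linear_minus _ _ _ j_linear).
apply: is_RInt_ext (is_RInt_minus _ _ _ _ _ _ h h') => s.
rewrite Rmin_left // Rmax_right // => hs; symmetry.
by apply: linear_minus; apply: sg_linear => //; lra.
Qed.

(** [J] is the improper integral in [X]. Below [t] the map [j] carries the truncated integrals to
    those of [F] in [Y], and the latter converge to the full integral because [F] is bounded up to
    [t]. The exponent [q] is left free because the weighted kernel is dominated with [q > omega]. *)
Lemma is_conv_singular (c t tau q C : R) (g : R -> Y) :
  q < 1 -> 0 <= C -> c < t -> t - c <= tau -> (forall s, continuous g s) ->
  (forall s, c <= s < t ->
    kap tau * Rpower (t - s) (- omega) * norm (g s) <= C * Rpower (t - s) (- q)) ->
  exists J, is_conv c t g J /\ norm J <= C * powint q (t - c).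
Proof.
move=> hq hC hct htau hg hb.
pose f s := smooth (t - s) (g s).
have hfb s : c <= s < t -> norm (f s) <= C * Rpower (t - s) (- q).
  by move=> hs; apply: Rle_trans (hb s hs); apply: smooth_bound; lra.
have hfc s : s < t -> continuous f s by move=> hs; exact: smooth_apply_continuous.
have [J [hJ hJn]] := ex_improper_RInt f q C c t hq hC hct hfb hfc.
exists J; split=> //.
pose F s := S (Rmax 0 (t - s)) (g s).
have hFc s : continuous F s by exact: semigroup_apply_continuous.
have hF u v : is_RInt F u v (RInt F u v).
  by apply: RInt_correct; apply: ex_RInt_continuous => z _.
have hjf u : c <= u < t -> j (RInt f c u) = RInt F c u.
  move=> hu; symmetry; apply: is_RInt_unique.
  apply: (is_RInt_ext (fun s => j (f s))).
    move=> s; rewrite Rmin_left ?Rmax_right; try lra; move=> hs.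
    by rewrite /f /F smoothE ?Rmax_right //; lra.
  apply: is_RInt_linear => //; apply: RInt_correct; apply: ex_RInt_continuous => z hz.
  by apply: hfc; apply: Rle_lt_trans (proj2 hz) _; rewrite Rmax_right; lra.
suff e : j J = RInt F c t.
  rewrite /is_conv e; apply: is_RInt_ext (hF c t) => s.
  rewrite Rmin_left ?Rmax_right; try lra; move=> hs.
  by rewrite /F Rmax_right //; lra.
have [K hK] := bounded_continuity F c t (fun s _ => hFc s).
have hK0 : 0 < K by apply: Rle_lt_trans (norm_ge_0 (F c)) (hK c _); lra.
apply: eq_of_small_dist => eps he.
have he2 : 0 < eps / 2 by lra.
have heK : 0 < Rmin (eps / (2 * K)) (t - c).
  by apply: Rmin_glb_lt; [apply: Rdiv_lt_0_compat; lra|lra].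
have m1' := Rmin_l (eps / (2 * K)) (t - c); have m2' := Rmin_r (eps / (2 * K)) (t - c).
pose proof (proj1 (filterlim_norm_eps _ _ _) hJ _ he2) as h1.
have h2 : at_left t (fun u => t - Rmin (eps / (2 * K)) (t - c) < u < t).
  exists (mkposreal _ heK) => y hy hyt; split=> //.
  by move/Rabs_def2: hy => /= [_]; rewrite /minus /plus /opp /=; lra.
have [u [hu1 hu2]] : exists u, norm (minus (RInt f c u) J) < eps / 2 /\
    t - Rmin (eps / (2 * K)) (t - c) < u < t.
  exact: (@filter_ex _ _ (at_left_proper_filter t) _ (filter_and _ _ h1 h2)).
apply: Rle_trans (norm_minus_triangle (j (RInt f c u)) _ _) _.
have h3 : norm (minus (j J) (j (RInt f c u))) <= eps / 2.
  rewrite -(linear_minus _ _ _ j_linear) norm_minus_sym in hu1 *.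
  by apply: Rle_trans (j_norm _) _; lra.
have h4 : norm (minus (j (RInt f c u)) (RInt F c t)) <= eps / 2.
  have e : RInt F c t = plus (RInt F c u) (RInt F u t).
    by apply: is_RInt_unique; apply: is_RInt_Chasles; apply: hF.
  rewrite hjf; last lra.
  rewrite norm_minus_sym e /minus (plus_comm (RInt F c u)) -plus_assoc plus_opp_r plus_zero_r.
  have hut : u <= t by lra.
  apply: Rle_trans (norm_RInt_le F (fun _ => K) u t _ _ hut _ (hF u t) (is_RInt_const u t K)) _.
    by move=> s hs; left; apply: hK; lra.
  rewrite /scal /= /mult /=.
  have -> : eps / 2 = eps / (2 * K) * K by field; lra.
  by apply: Rmult_le_compat_r; lra.
apply: Rle_trans (Rplus_le_compat _ _ _ _ h3 h4) _; lra.
Qed.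

Lemma is_conv_point (c : R) (g : R -> Y) : is_conv c c g zero.
Proof. by rewrite /is_conv j_zero; exact: is_RInt_point. Qed.

(** A separate [d > 0] allows [t = c], where [powint q (t - c)] is not the integral, and gives a
    bound uniform over short intervals. *)
Lemma is_conv_singular_le (c t tau q C d : R) (g : R -> Y) (J : X) :
  q < 1 -> 0 <= C -> c <= t -> t - c <= tau -> 0 < d -> t - c <= d ->
  (forall s, continuous g s) ->
  (forall s, c <= s < t ->
    kap tau * Rpower (t - s) (- omega) * norm (g s) <= C * Rpower (t - s) (- q)) ->
  is_conv c t g J -> norm J <= C * powint q d.
Proof.
move=> hq hC hct htau hd htd hg hb hJ.
case: hct => hct.
  have [J' [hJ' hn]] := is_conv_singular c t tau q C g hq hC hct htau hg hb.
  rewrite (is_conv_unique _ _ _ _ _ hJ hJ'); apply: Rle_trans hn _.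
  by apply: Rmult_le_compat_l => //; apply: powint_le; lra.
rewrite -hct in hJ; rewrite (is_conv_unique _ _ _ _ _ hJ (is_conv_point c g)) norm_zero.
by apply: Rmult_le_pos => //; left; exact: powint_gt0.
Qed.

Lemma is_conv_bounded_le (c t tau G d : R) (g : R -> Y) (J : X) :
  0 <= G -> c <= t -> t - c <= tau -> 0 < d -> t - c <= d ->
  (forall s, continuous g s) -> (forall s, c <= s <= t -> norm (g s) <= G) ->
  is_conv c t g J -> norm J <= kap tau * G * powint omega d.
Proof.
move=> hG hct htau hd htd hg hb.
have hk : 0 < kap tau by exact: smoothing_const_gt0.
apply: (is_conv_singular_le c t tau) => //; try lra.
  by apply: Rmult_le_pos; lra.
move=> s hs; rewrite Rmult_assoc (Rmult_comm (Rpower _ _)) -Rmult_assoc.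
apply: Rmult_le_compat_r; first by left; exact: exp_pos.
by apply: Rmult_le_compat_l; [lra|apply: hb; lra].
Qed.

Lemma ex_conv (c t : R) (g : R -> Y) : c <= t -> (forall s, continuous g s) ->
  exists J, is_conv c t g J.
Proof.
case=> [hct|->] hg; last by exists zero; exact: is_conv_point.
have [G hG] := bounded_continuity g c t (fun s _ => hg s).
have hG0 : 0 < G by apply: Rle_lt_trans (norm_ge_0 (g c)) (hG c _); lra.
have hk : 0 < kap (t - c) by exact: smoothing_const_gt0.
have hC : 0 <= kap (t - c) * G by apply: Rmult_le_pos; lra.
have [||s hs|J [hJ _]] := is_conv_singular c t (t - c) omega _ g _ hC hct _ hg; try lra.
  rewrite Rmult_assoc (Rmult_comm (Rpower _ _)) -Rmult_assoc.
  apply: Rmult_le_compat_r; first by left; exact: exp_pos.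
  by apply: Rmult_le_compat_l; [lra|left; apply: hG; lra].
by exists J.
Qed.

(** By the semigroup law the part of the integral over [[a, c]] is the earlier convolution
    transported by [S1 (t - c)], so only the short interval [[c, t]] remains to be estimated. *)
Lemma is_conv_shift (a c t : R) (g : R -> Y) (Jc Jt : X) : a <= c -> c <= t ->
  (forall s, continuous g s) -> is_conv a c g Jc -> is_conv a t g Jt ->
  is_conv c t g (minus Jt (S1 (t - c) Jc)).
Proof.
move=> hac hct hg hc ht.
have [J hJ] := ex_conv c t g hct hg.
suff -> : Jt = plus (S1 (t - c) Jc) J.
  by rewrite /minus (plus_comm (S1 _ _)) -plus_assoc plus_opp_r plus_zero_r.
have htc : 0 <= t - c by lra.
apply: (is_conv_unique a t g) => //; rewrite /is_conv (linear_plus _ j_linear).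
apply: is_RInt_Chasles hJ; rewrite S_restrict //.
apply: (is_RInt_ext (fun s => S (t - c) (S (c - s) (g s)))).
  move=> s; rewrite Rmin_left // Rmax_right // => hs.
  by rewrite -(sg_add _ S_semigroup); try lra; congr S; lra.
by apply: is_RInt_linear => //; exact: sg_linear.
Qed.

(* [J t] and the continuous curve [S1 (t - c) (J c)] differ by [O((t - c)^(1 - omega))]
   for [t] slightly larger than [c]; taking [c] just below [t0] handles both sides of [t0]. *)
Lemma conv_continuous (a : R) (g : R -> Y) (J : R -> X) :
  (forall s, continuous g s) -> (forall t, a <= t -> is_conv a t g (J t)) ->
  forall t, continuous (fun s => J (Rmax a s)) t.
Proof.
move=> hg hJ t; set t0 := Rmax a t; have ht0 : a <= t0 := Rmax_l a t.
apply/continuous_eps => eps he.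
have [G hG] := bounded_continuity g a (t0 + 1) (fun s _ => hg s).
have hG0 : 0 < G by apply: Rle_lt_trans (norm_ge_0 (g a)) (hG a _); lra.
set tau := t0 + 1 - a.
have hk : 0 < kap tau by exact: smoothing_const_gt0.
have hC : 0 <= kap tau * G by apply: Rmult_le_pos; lra.
have he3 : 0 < eps / 3 by lra.
have homega1 : omega < 1 by lra.
have [d [d0 hd]] := powint_small omega (kap tau * G) (eps / 3) homega1 hC he3.
pose c := Rmax a (t0 - d / 2).
have hac : a <= c := Rmax_l _ _.
have hcd : t0 - d / 2 <= c := Rmax_r _ _.
have hct : c <= t0 by apply: Rmax_lub; lra.
have key s : a <= s -> c <= s -> s <= t0 + 1 -> s - c <= d ->
    norm (minus (J s) (S1 (s - c) (J c))) < eps / 3.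
  move=> has hcs hs1 hsd; apply: Rle_lt_trans hd.
  apply: (is_conv_bounded_le c s tau G d g) => //; try (rewrite /tau; lra).
    by move=> u hu; left; apply: hG; lra.
  by apply: (is_conv_shift a) => //; exact: hJ.
have h1 : continuous (fun s => S1 (Rmax 0 s) (J c)) (t0 - c).
  exact: (semigroup_continuous S1 M1 m1).
have [d2 [d20 hd2]] := proj1 (continuous_eps _ _) h1 _ he3.
have hm0 : 0 < Rmin (Rmin (d / 2) 1) d2 by repeat apply: Rmin_glb_lt; lra.
exists (Rmin (Rmin (d / 2) 1) d2); split=> // s hs.
have := Rle_lt_trans _ _ _ (Rmax_contraction a t s) hs; rewrite -/t0.
set s' := Rmax a s => hs'; have has : a <= s' := Rmax_l a s.
have l1 := Rmin_l (Rmin (d / 2) 1) d2; have l2 := Rmin_r (Rmin (d / 2) 1) d2.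
have l3 := Rmin_l (d / 2) 1; have l4 := Rmin_r (d / 2) 1.
have hs2 : Rabs (s' - c - (t0 - c)) < d2.
  by have -> : s' - c - (t0 - c) = s' - t0 by [ring]; lra.
move/Rabs_def2: (hs') => hs3.
have hcs : c <= s' by apply: Rmax_lub; lra.
have := hd2 _ hs2; rewrite !Rmax_right; try lra; move=> h2.
have h3 : norm (minus (J s') (S1 (s' - c) (J c))) < eps / 3 by apply: key; lra.
have h4 : norm (minus (J t0) (S1 (t0 - c) (J c))) < eps / 3 by apply: key; lra.
rewrite norm_minus_sym in h4.
apply: Rle_lt_trans (norm_minus_triangle (S1 (s' - c) (J c)) _ _) _.
have h5 := Rle_lt_trans _ _ _ (norm_minus_triangle (S1 (t0 - c) (J c)) (S1 (s' - c) (J c)) (J t0))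
  (Rplus_lt_compat _ _ _ _ h2 h4).
apply: Rlt_le_trans (Rplus_lt_compat _ _ _ _ h3 h5) _; lra.
Qed.


(** The weight at [s] factors as [exp (- lam (t - s)) * exp (lam (t - a))]: the first factor damps
    the kernel, the second comes out of the integral. *)
Lemma is_conv_weighted (a t tau eps lam G : R) (g : R -> Y) (J : X) :
  0 < tau -> weight_controls (kap tau) omega tau eps lam ->
  0 <= G -> a <= t <= a + tau -> (forall s, continuous g s) ->
  (forall s, a <= s <= t -> norm (g s) <= G * exp (lam * (s - a))) ->
  is_conv a t g J -> norm J <= eps * G * exp (lam * (t - a)).
Proof.
move=> htau [hlam [q [C [hq [hC [hCe hw]]]]]] hG ht hg hb hJ.
have hGe : 0 <= G * exp (lam * (t - a)) by exact: mult_exp_ge0.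
have hk : 0 < kap tau by exact: smoothing_const_gt0.
apply: (Rle_trans _ (C * (G * exp (lam * (t - a))) * powint q tau)).
  apply: (is_conv_singular_le a t tau q _ tau g J hq) => //; try lra.
    exact: Rmult_le_pos.
  move=> s hs.
  have hR : 0 < Rpower (t - s) (- omega) := exp_pos _.
  have h1 : norm (g s) <= G * exp (lam * (s - a)) by apply: hb; lra.
  apply: Rle_trans (Rmult_le_compat_l _ _ _ _ h1) _; first by apply: Rmult_le_pos; lra.
  have -> : lam * (s - a) = - lam * (t - s) + lam * (t - a) by ring.
  have hts : 0 < t - s by lra.
  rewrite exp_plus; have := Rmult_le_compat_r _ _ _ hGe (hw (t - s) hts); lra.
rewrite -Rmult_assoc (Rmult_comm _ (powint _ _)) -!Rmult_assoc.
apply: Rmult_le_compat_r; first by left; exact: exp_pos.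
by apply: Rmult_le_compat_r => //; rewrite Rmult_comm.
Qed.

Lemma S1_weighted (a t tau lam : R) (y : X) : 0 <= lam -> a <= t <= a + tau ->
  norm (S1 (t - a) y) <= M1 * exp (m1 * tau) * norm y * exp (lam * (t - a)).
Proof.
move=> hlam ht; have hta : 0 <= t - a by lra.
apply: Rle_trans (S1_bound _ hta y) _.
rewrite -[X in X <= _]Rmult_1_r; apply: Rmult_le_compat; try lra.
- by apply: Rmult_le_pos; [exact: mult_exp_ge0|exact: norm_ge_0].
- apply: Rmult_le_compat_r; first exact: norm_ge_0.
  by apply: Rmult_le_compat_l => //; apply: exp_le_mono; apply: Rmult_le_compat_l; lra.
- by rewrite -exp_0; apply: exp_le_mono; apply: Rmult_le_pos.
Qed.

Definition preserves_continuity (F : R -> X -> Y) : Prop :=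
  forall b : R -> X, (forall t, continuous b t) -> forall t, continuous (fun s => F s (b s)) t.

(** * Mild solutions *)

(* Solutions on [t >= a] are represented by curves continuous on all of [R], whose values
   for [t < a] are irrelevant. *)
Definition is_mild (F : R -> X -> Y) (a : R) (y : X) (b : R -> X) : Prop :=
  (forall t, continuous b t) /\
  forall t, a <= t -> exists J, is_conv a t (fun s => F s (b s)) J /\
    b t = plus (S1 (t - a) y) J.

(** [b] is any continuous curve and the bound concerns its Picard image, so the lemma serves both
    the iterates and the solutions. *)
Lemma mild_step_bound (F : R -> X -> Y) (N a t tau eps lam G : R) (y J : X) (b : R -> X) :
  preserves_continuity F -> 0 <= N -> (forall s x, norm (F s x) <= N * norm x) ->
  0 < tau -> weight_controls (kap tau) omega tau eps lam -> eps * N <= / 2 ->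
  0 <= G -> (forall s, continuous b s) ->
  (forall s, a <= s <= a + tau -> norm (b s) <= G * exp (lam * (s - a))) ->
  a <= t <= a + tau -> is_conv a t (fun s => F s (b s)) J ->
  norm (plus (S1 (t - a) y) J) <=
    (M1 * exp (m1 * tau) * norm y + G / 2) * exp (lam * (t - a)).
Proof.
move=> hF hN hFN htau hw heps hG hb hbG ht hJ.
have hlam : 0 <= lam by case: hw; lra.
apply: Rle_trans (norm_triangle _ _) _; rewrite Rmult_plus_distr_r.
apply: Rplus_le_compat; first exact: S1_weighted.
have hNG : 0 <= N * G by exact: Rmult_le_pos.
apply: Rle_trans (is_conv_weighted a t tau eps lam (N * G) _ J htau hw hNG ht (hF b hb) _ hJ) _.
  move=> s hs; apply: Rle_trans (hFN _ _) _; rewrite Rmult_assoc.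
  by apply: Rmult_le_compat_l => //; apply: hbG; lra.
apply: Rmult_le_compat_r; first by left; exact: exp_pos.
by have := Rmult_le_compat_r _ _ _ hG heps; lra.
Qed.

(** [P] measures the distance between the two nonlinearities: it is 0 for the contraction and
    proportional to the change of parameter for the dependence on [alpha]. *)
Lemma mild_step_lipschitz (F F' : R -> X -> Y) (P L L' c R0 a t tau eps lam G : R)
    (y y' J J' : X) (b b' : R -> X) :
  preserves_continuity F -> preserves_continuity F' ->
  0 <= P -> 0 <= L -> 0 <= L' -> 0 <= c ->
  (forall s x x', norm (minus (F s x) (F' s x')) <=
     P * (1 + c * norm x) + L * norm (minus x x') * (1 + L' * norm x)) ->
  0 < tau -> weight_controls (kap tau) omega tau eps lam ->
  eps * (L * (1 + L' * R0)) <= / 2 -> 0 <= R0 -> 0 <= G ->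
  (forall s, continuous b s) -> (forall s, continuous b' s) ->
  (forall s, a <= s <= a + tau -> norm (b s) <= R0) ->
  (forall s, a <= s <= a + tau -> norm (minus (b s) (b' s)) <= G * exp (lam * (s - a))) ->
  a <= t <= a + tau ->
  is_conv a t (fun s => F s (b s)) J -> is_conv a t (fun s => F' s (b' s)) J' ->
  norm (minus (plus (S1 (t - a) y) J) (plus (S1 (t - a) y') J')) <=
    (M1 * exp (m1 * tau) * norm (minus y y') + eps * (P * (1 + c * R0)) + G / 2)
    * exp (lam * (t - a)).
Proof.
move=> hF hF' hP hL hL' hc hFF htau hw heps hR hG hb hb' hbR hbG ht hJ hJ'.
have hlam : 0 <= lam by case: hw; lra.
have hta : 0 <= t - a by lra.
rewrite minus_plus_plus -(linear_minus _ _ _ (sg_linear _ S1_semigroup _ hta)).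
apply: Rle_trans (norm_triangle _ _) _.
rewrite Rplus_assoc Rmult_plus_distr_r.
apply: Rplus_le_compat; first exact: S1_weighted.
set Q := P * (1 + c * R0) + L * (1 + L' * R0) * G.
have hPc : 0 <= P * (1 + c * R0).
  by apply: Rmult_le_pos => //; have := Rmult_le_pos _ _ hc hR; lra.
have hLL : 0 <= L * (1 + L' * R0).
  by apply: Rmult_le_pos => //; have := Rmult_le_pos _ _ hL' hR; lra.
have hQ : 0 <= Q by have := Rmult_le_pos _ _ hLL hG; rewrite /Q; lra.
have hat : a <= t by lra.
have hgc s : continuous (fun s => minus (F s (b s)) (F' s (b' s))) s.
  by apply: continuous_minus; [exact: hF|exact: hF'].
have hJJ := is_conv_minus a t _ _ J J' hat hJ hJ'.
apply: Rle_trans (is_conv_weighted a t tau eps lam Q _ _ htau hw hQ ht hgc _ hJJ) _.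
  move=> s hs; apply: Rle_trans (hFF _ _ _) _.
  have hs' : a <= s <= a + tau by lra.
  have h1 := hbR s hs'; have h2 := hbG s hs'.
  (* Lets the [P]-term, which carries no weight, be absorbed into [Q] times the weight. *)
  have he : 1 <= exp (lam * (s - a)).
    by rewrite -exp_0; apply: exp_le_mono; apply: Rmult_le_pos; lra.
  have n1 := norm_ge_0 (b s); have n2 := norm_ge_0 (minus (b s) (b' s)).
  have h3 : c * norm (b s) <= c * R0 by exact: Rmult_le_compat_l.
  have h4 : L' * norm (b s) <= L' * R0 by exact: Rmult_le_compat_l.
  have h5 : 0 <= L' * norm (b s) by exact: Rmult_le_pos.
  rewrite /Q Rmult_plus_distr_r; apply: Rplus_le_compat.
    apply: (Rle_trans _ (P * (1 + c * R0))); first by apply: Rmult_le_compat_l; lra.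
    by rewrite -{1}(Rmult_1_r (P * _)); apply: Rmult_le_compat_l.
  apply: (Rle_trans _ (L * (G * exp (lam * (s - a))) * (1 + L' * R0))); last by right; ring.
  apply: Rmult_le_compat; [exact: Rmult_le_pos|lra| |lra].
  exact: Rmult_le_compat_l.
apply: Rmult_le_compat_r; first by left; exact: exp_pos.
by have := Rmult_le_compat_r _ _ _ hG heps; rewrite /Q; lra.
Qed.

Lemma mild_bound (F : R -> X -> Y) (N a tau eps lam : R) (y : X) (b : R -> X) :
  preserves_continuity F -> 0 <= N -> (forall s x, norm (F s x) <= N * norm x) ->
  0 < tau -> weight_controls (kap tau) omega tau eps lam -> eps * N <= / 2 ->
  is_mild F a y b ->
  forall t, a <= t <= a + tau ->
    norm (b t) <= 2 * (M1 * exp (m1 * tau) * norm y) * exp (lam * (t - a)).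
Proof.
move=> hF hN hFN htau hw heps [hb hmild].
apply: weighted_gronwall => //; first lra.
move=> G hG hbG s hs.
have [J [hJ ->]] := hmild s (proj1 hs).
exact: (mild_step_bound F N a s tau eps lam G y J b).
Qed.

Lemma mild_lipschitz (F F' : R -> X -> Y) (P L L' c R0 a tau eps lam : R)
    (y y' : X) (b b' : R -> X) :
  preserves_continuity F -> preserves_continuity F' ->
  0 <= P -> 0 <= L -> 0 <= L' -> 0 <= c ->
  (forall s x x', norm (minus (F s x) (F' s x')) <=
     P * (1 + c * norm x) + L * norm (minus x x') * (1 + L' * norm x)) ->
  0 < tau -> weight_controls (kap tau) omega tau eps lam ->
  eps * (L * (1 + L' * R0)) <= / 2 -> 0 <= R0 ->
  (forall s, a <= s <= a + tau -> norm (b s) <= R0) ->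
  is_mild F a y b -> is_mild F' a y' b' ->
  forall t, a <= t <= a + tau ->
    norm (minus (b t) (b' t)) <=
    2 * (M1 * exp (m1 * tau) * norm (minus y y') + eps * (P * (1 + c * R0)))
      * exp (lam * (t - a)).
Proof.
move=> hF hF' hP hL hL' hc hFF htau hw heps hR hbR [hb hmild] [hb' hmild'].
apply: (weighted_gronwall (fun t => minus (b t) (b' t))); first lra.
  by move=> t; exact: continuous_minus.
move=> G hG hbG s hs.
have [J [hJ ->]] := hmild s (proj1 hs).
have [J' [hJ' ->]] := hmild' s (proj1 hs).
exact: (mild_step_lipschitz F F' P L L' c R0 a s tau eps lam G y y' J J' b b').
Qed.

(** Clamping time in both terms makes the image constant before [a], hence continuous on all of [R]
    like its argument. *)
Definition picard_step (F : R -> X -> Y) (a : R) (y : X) (b : R -> X) (t : R) : X :=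
  plus (S1 (Rmax 0 (t - a)) y)
       (epsilon (inhabits zero) (is_conv a (Rmax a t) (fun s => F s (b s)))).

Lemma picard_stepE (F : R -> X -> Y) (a t : R) (y : X) (b : R -> X) :
  preserves_continuity F -> (forall s, continuous b s) -> a <= t ->
  exists J, is_conv a t (fun s => F s (b s)) J /\
            picard_step F a y b t = plus (S1 (t - a) y) J.
Proof.
move=> hF hb hat; rewrite /picard_step !Rmax_right //; last lra.
eexists; split; last by [].
by apply: epsilon_spec; apply: ex_conv => //; exact: hF.
Qed.

Lemma picard_step_continuous (F : R -> X -> Y) (a : R) (y : X) (b : R -> X) :
  preserves_continuity F -> (forall s, continuous b s) ->
  forall t, continuous (picard_step F a y b) t.
Proof.
move=> hF hb t; apply: continuous_plus.
  apply: (continuous_comp (fun t => t - a) (fun t => S1 (Rmax 0 t) y)).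
    by apply: (ex_derive_continuous (fun t => t - a)); auto_derive.
  exact: (semigroup_continuous S1 M1 m1).
apply: (conv_continuous a (fun s => F s (b s))
          (fun t => epsilon (inhabits zero) (is_conv a t (fun s => F s (b s))))).
  exact: hF.
by move=> s hs; apply: epsilon_spec; apply: ex_conv => //; exact: hF.
Qed.

Lemma ex_mild (F : R -> X -> Y) (N L L' a : R) (y : X) :
  preserves_continuity F -> 0 <= N -> 0 <= L -> 0 <= L' ->
  (forall s x, norm (F s x) <= N * norm x) ->
  (forall s x x', norm (minus (F s x) (F s x')) <=
     L * norm (minus x x') * (1 + L' * norm x)) ->
  exists b, is_mild F a y b.
Proof.
move=> hF hN hL hL' hFN hFL.
have hFL0 s x x' : norm (minus (F s x) (F s x')) <=
     0 * (1 + 0 * norm x) + L * norm (minus x x') * (1 + L' * norm x).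
  by have := hFL s x x'; lra.
pose b := fix b k := if k is k'.+1 then picard_step F a y (b k') else fun t => S1 (Rmax 0 (t - a)) y.
have hb k t : continuous (b k) t.
  elim: k t => [|k ih] t /=; last exact: picard_step_continuous.
  apply: (continuous_comp (fun t => t - a) (fun t => S1 (Rmax 0 t) y)).
    by apply: (ex_derive_continuous (fun t => t - a)); auto_derive.
  exact: (semigroup_continuous S1 M1 m1).
have hstep k t : a <= t -> exists J, is_conv a t (fun s => F s (b k s)) J /\
      b k.+1 t = plus (S1 (t - a) y) J.
  by move=> hat; apply: picard_stepE => //; exact: hb.
have hk tau : 0 < kap tau by exact: smoothing_const_gt0.
have hR tau : 0 < tau -> exists R0, 0 <= R0 /\
    forall k t, a <= t <= a + tau -> norm (b k t) <= R0.
  move=> htau; have [he1 he2] := half_inv N hN.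
  have [lam hw] := ex_weight _ _ tau _ (hk tau) homega he1.
  have hlam : 0 < lam by case: hw.
  set C := M1 * exp (m1 * tau) * norm y.
  have hC : 0 <= C by apply: Rmult_le_pos; [exact: mult_exp_ge0|exact: norm_ge_0].
  (* [2 * C] is the fixed point of [G |-> C + G / 2], so the step reproduces the bound. *)
  have hind k t : a <= t <= a + tau -> norm (b k t) <= 2 * C * exp (lam * (t - a)).
    elim: k t => [|k ih] t ht.
      rewrite /= Rmax_right; last lra.
      apply: Rle_trans (S1_weighted a t tau lam y _ ht) _; first lra.
      by apply: Rmult_le_compat_r; [left; exact: exp_pos|rewrite -/C; lra].
    have [J [hJ ->]] := hstep k t (proj1 ht).
    have hC2 : 0 <= 2 * C by lra.
    apply: Rle_trans (mild_step_bound F N a t tau _ lam (2 * C) y J (b k)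
      hF hN hFN htau hw he2 hC2 (hb k) ih ht hJ) _.
    by apply: Rmult_le_compat_r; [left; exact: exp_pos|rewrite -/C; lra].
  exists (2 * C * exp (lam * tau)); split; first by apply: mult_exp_ge0; lra.
  move=> k t ht; apply: Rle_trans (hind k t ht) _; apply: Rmult_le_compat_l; first lra.
  by apply: exp_le_mono; apply: Rmult_le_compat_l; lra.
(* [beta] is left arbitrary: the next iterate gives the geometric rate, the limit curve gives the
   equation. Only the iterates have to lie in the ball of radius [R0]. *)
have hcontr tau : 0 < tau -> exists lam, 0 < lam /\ forall beta, (forall s, continuous beta s) ->
    forall k G, 0 <= G ->
    (forall s, a <= s <= a + tau -> norm (minus (b k s) (beta s)) <= G * exp (lam * (s - a))) ->
    forall t J, a <= t <= a + tau -> is_conv a t (fun s => F s (beta s)) J ->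
    norm (minus (b k.+1 t) (plus (S1 (t - a) y) J)) <= G / 2 * exp (lam * (t - a)).
  move=> htau; have [R0 [hR0 hbR]] := hR _ htau.
  have hz : 0 <= L * (1 + L' * R0).
    by apply: Rmult_le_pos => //; have := Rmult_le_pos _ _ hL' hR0; lra.
  have [he1 he2] := half_inv _ hz.
  have [lam hw] := ex_weight _ _ tau _ (hk tau) homega he1.
  exists lam; split; first by case: hw.
  move=> beta hbeta k G hG hd t J ht hJ.
  have [J0 [hJ0 ->]] := hstep k t (proj1 ht).
  have h0 : 0 <= 0 by lra.
  apply: Rle_trans (mild_step_lipschitz F F 0 L L' 0 R0 a t tau _ lam G y y J0 J (b k) beta
    hF hF h0 hL hL' h0 hFL0 htau hw he2 hR0 hG (hb k) hbeta (hbR k) hd ht hJ0 hJ) _.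
  by rewrite minus_eq_zero norm_zero; right; ring.
have hgeo T : a < T -> exists E, 0 <= E /\ forall k t, a <= t <= T ->
    norm (minus (b k.+1 t) (b k t)) <= E * (/ 2) ^ k.
  move=> hT; have htau : 0 < T - a by lra.
  have [R0 [hR0 hbR]] := hR _ htau.
  have [lam [hlam hc]] := hcontr _ htau.
  have hp k : 0 < (/ 2) ^ k by apply: pow_lt; lra.
  have hind k t : a <= t <= a + (T - a) ->
      norm (minus (b k t) (b k.+1 t)) <= 2 * R0 * (/ 2) ^ k * exp (lam * (t - a)).
    elim: k t => [|k ih] t ht.
      have h1 := hbR 0%nat t ht; have h2 := hbR 1%nat t ht.
      have he : 1 <= exp (lam * (t - a)).
        by rewrite -exp_0; apply: exp_le_mono; apply: Rmult_le_pos; lra.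
      have := Rmult_le_compat_l _ _ _ hR0 he.
      have := norm_triangle (b 0%nat t) (opp (b 1%nat t)); rewrite norm_opp.
      rewrite -/(minus (b 0%nat t) (b 1%nat t)) [(/ 2) ^ 0]/=.
      by move=> h3 h4; apply: Rle_trans h3 _; lra.
    have [J [hJ ->]] := hstep k.+1 t (proj1 ht).
    have hG : 0 <= 2 * R0 * (/ 2) ^ k by have := hp k; have := Rmult_le_pos _ _ hR0 (Rlt_le _ _ (hp k)); lra.
    apply: Rle_trans (hc _ (hb k.+1) k _ hG ih t J ht hJ) _.
    by right; rewrite [(/ 2) ^ k.+1]/=; field.
  exists (2 * R0 * exp (lam * (T - a))); split; first by apply: mult_exp_ge0; lra.
  move=> k t ht; rewrite norm_minus_sym.
  have ht' : a <= t <= a + (T - a) by lra.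
  apply: Rle_trans (hind k t ht') _.
  rewrite Rmult_assoc (Rmult_comm (_ ^ _)) -Rmult_assoc.
  apply: Rmult_le_compat_r; first by left.
  apply: Rmult_le_compat_l; first lra.
  by apply: exp_le_mono; apply: Rmult_le_compat_l; lra.
have [beta [hbeta hlim]] := geometric_limit a b hb hgeo.
exists beta; split=> // t hat.
have hFb := hF beta hbeta.
have [J hJ] := ex_conv a t _ hat hFb.
exists J; split=> //.
have hT : a < t + 1 by lra.
have [E [hE hEk]] := hlim _ hT.
have htau : 0 < t + 1 - a by lra.
have [lam [hlam hc]] := hcontr _ htau.
apply: eq_of_small_dist => eps he.
set W := exp (lam * (t - a)).
have hW : 0 < W := exp_pos _.
have hEW : 0 <= E + E * W by have := Rmult_le_pos _ _ hE (Rlt_le _ _ hW); lra.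
have [k hk2] := half_pow_small _ _ hEW he.
have {}hk2 := hk2 k (le_n k).
have hp : 0 < (/ 2) ^ k by apply: pow_lt; lra.
have ht : a <= t <= t + 1 by lra.
have h1 := hEk k.+1 t ht; rewrite norm_minus_sym in h1.
have hG : 0 <= E * (/ 2) ^ k by apply: Rmult_le_pos; lra.
(* The iterates approach the Picard image of [beta] as well as [beta], so the two coincide. *)
have h2 : norm (minus (b k.+1 t) (plus (S1 (t - a) y) J)) <= E * (/ 2) ^ k / 2 * W.
  apply: (hc beta hbeta k _ hG) => //; last lra.
  move=> s hs; have hs' : a <= s <= t + 1 by lra.
  apply: Rle_trans (hEk k s hs') _; rewrite -{1}(Rmult_1_r (E * _)).
  apply: Rmult_le_compat_l => //; rewrite -exp_0; apply: exp_le_mono.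
  by apply: Rmult_le_pos; lra.
apply: Rle_trans (norm_minus_triangle (b k.+1 t) _ _) _.
apply: Rle_trans (Rplus_le_compat _ _ _ _ h1 h2) _.
rewrite [(/ 2) ^ k.+1]/=.
have h3 : 0 <= E * (/ 2) ^ k * W by apply: Rmult_le_pos => //; lra.
lra.
Qed.
End Convolution.

(** * The nonlinearity and the theorem *)

Lemma big_Rplus_bounds (n : nat) (f : 'I_n -> R) (c : R) :
  (forall i, 0 <= f i <= c) -> 0 <= \big[Rplus/0]_(i < n) f i <= INR n * c.
Proof.
elim: n f => [|n ih] f hf; first by rewrite big_ord0 /=; lra.
rewrite big_ord_recl S_INR; have := ih _ (fun i => hf (lift ord0 i)); have := hf ord0.
lra.
Qed.

Lemma sum_norms_ge0 {B : Banach} (n : nat) (b : 'I_n -> B) : 0 <= sum_norms n b.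
Proof.
rewrite /sum_norms.
elim: n b => [|n ih] b; first by rewrite big_ord0; lra.
by rewrite big_ord_recl; have := ih (fun i => b (lift ord0 i)); have := norm_ge_0 (b ord0); lra.
Qed.

Lemma sum_norms_le {B : Banach} (n : nat) (b : 'I_n -> B) (c : R) :
  (forall i, norm (b i) <= c) -> sum_norms n b <= INR n * c.
Proof.
move=> h; apply: (proj2 (big_Rplus_bounds n (fun i => norm (b i)) c _)) => i.
by split; [exact: norm_ge_0|exact: h].
Qed.

Section Nonlinearity.

Context {B1 B Bpar : Banach} (n : nat) (j : B1 -> B) (D : 'I_n -> B1 -> B).
Context (H : R -> B -> ('I_n -> B) -> Bpar -> B) (LH LH' LHpar : R).
Hypothesis j_linear : is_linear j.
Hypothesis j_norm : forall x, norm (j x) <= norm x.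
Hypothesis D_linear : forall i, is_linear (D i).
Hypothesis D_norm : forall i x, norm (D i x) <= norm x.
Hypothesis hH : assumption_H n H LH LH' LHpar.

Definition nonlinearity (alpha : Bpar) (s : R) (x : B1) : B :=
  H s (j x) (fun i => D i x) alpha.

Lemma nonlinearity_bound (alpha : Bpar) (s : R) (x : B1) :
  norm (nonlinearity alpha s x) <= Rmax LH 0 * INR n * norm x.
Proof.
have [_ [_ [_ h]]] := hH; apply: Rle_trans (h _ _ _ _) _.
have h1 := sum_norms_le n (fun i => D i x) (norm x) (fun i => D_norm i x).
have h0 := sum_norms_ge0 n (fun i => D i x).
have m1 := Rmax_l LH 0; have m2 := Rmax_r LH 0.
rewrite Rmult_assoc; apply: Rle_trans (Rmult_le_compat_r _ _ _ h0 m1) _.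
exact: Rmult_le_compat_l.
Qed.

(** [LH] and [LH'] may have any sign, while the step lemmas take nonnegative constants; positive
    parts replace them. *)
Lemma H_lipschitz (t : R) (b0 c0 : B) (b c : 'I_n -> B) (alpha : Bpar) :
  norm (minus (H t b0 b alpha) (H t c0 c alpha)) <=
  Rmax LH 0 * (norm (minus b0 c0) + sum_norms n (fun j => minus (b j) (c j)))
    * (1 + Rmax LH' 0 * sum_norms n b).
Proof.
have [_ [h [_ hb]]] := hH.
have hs := sum_norms_ge0 n b.
have hX : 0 <= norm (minus b0 c0) + sum_norms n (fun j => minus (b j) (c j)).
  by have := norm_ge_0 (minus b0 c0); have := sum_norms_ge0 n (fun j => minus (b j) (c j)); lra.
have hfac : 1 + LH' * sum_norms n b <= 1 + Rmax LH' 0 * sum_norms n b.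
  by have := Rmult_le_compat_r _ _ _ hs (Rmax_l LH' 0); lra.
case: (Rle_dec 0 LH) => hL.
  rewrite (Rmax_left LH) //; apply: Rle_trans (h _ _ _ _ _ _) _.
  by apply: Rmult_le_compat_l => //; exact: Rmult_le_pos.
(* For [LH < 0] the growth bound forces [H = 0]. *)
have hz b1 b2 : norm (H t b1 b2 alpha) <= 0.
  apply: Rle_trans (hb _ _ _ _) _.
  have := sum_norms_ge0 n b2 => hs2; have : 0 <= - LH * sum_norms n b2 by apply: Rmult_le_pos; lra.
  lra.
rewrite (Rmax_right LH); last lra.
rewrite !Rmult_0_l; apply: Rle_trans (norm_triangle _ _) _; rewrite norm_opp.
by have := hz b0 b; have := hz c0 c; lra.
Qed.

(** Change the parameter first, at the fixed point [x], and the point afterwards: both growth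
    factors are then evaluated at [x]. *)
Lemma nonlinearity_lipschitz (alpha alpha' : Bpar) (s : R) (x x' : B1) :
  norm (minus (nonlinearity alpha s x) (nonlinearity alpha' s x')) <=
  Rabs LHpar * norm (minus alpha alpha') * (1 + INR n * norm x) +
  Rmax LH 0 * (1 + INR n) * norm (minus x x') * (1 + Rmax LH' 0 * INR n * norm x).
Proof.
have [_ [_ [hpar _]]] := hH.
apply: Rle_trans (norm_minus_triangle (nonlinearity alpha' s x) _ _) _.
have h1 := sum_norms_le n (fun i => D i x) (norm x) (fun i => D_norm i x).
have h0 := sum_norms_ge0 n (fun i => D i x).
apply: Rplus_le_compat.
  apply: Rle_trans (hpar _ _ _ _ _) _.
  have hn := norm_ge_0 (minus alpha alpha').
  apply: (Rle_trans _ (Rabs LHpar * norm (minus alpha alpha') * (1 + sum_norms n (fun i => D i x)))).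
    apply: Rmult_le_compat_r; first lra.
    by apply: Rmult_le_compat_r => //; exact: Rle_abs.
  apply: Rmult_le_compat_l; last lra.
  by apply: Rmult_le_pos => //; exact: Rabs_pos.
apply: Rle_trans (H_lipschitz _ _ _ _ _ _) _.
have mL := Rmax_r LH 0; have mL' := Rmax_r LH' 0.
have hx := norm_ge_0 (minus x x').
have hj : norm (minus (j x) (j x')) <= norm (minus x x').
  by rewrite -(linear_minus _ _ _ j_linear); exact: j_norm.
have hD : sum_norms n (fun i => minus (D i x) (D i x')) <= INR n * norm (minus x x').
  by apply: sum_norms_le => i; rewrite -(linear_minus _ _ _ (D_linear i)); exact: D_norm.
have hD0 := sum_norms_ge0 n (fun i => minus (D i x) (D i x')).
have hj0 := norm_ge_0 (minus (j x) (j x')).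
apply: Rmult_le_compat.
- by apply: Rmult_le_pos => //; lra.
- by have := Rmult_le_pos _ _ mL' h0; lra.
- by rewrite Rmult_assoc; apply: Rmult_le_compat_l => //; lra.
- by rewrite Rmult_assoc; have := Rmult_le_compat_l _ _ _ mL' h1; lra.
Qed.

Lemma nonlinearity_continuous (alpha : Bpar) :
  preserves_continuity (nonlinearity alpha).
Proof.
move=> b hb t; have [hc _] := hH.
apply: (continuous_comp
  (fun s => (s, j (b s), (fun i => D i (b s)), alpha) : R * B * ('I_n -> B) * Bpar)
  (fun q => H q.1.1.1 q.1.1.2 q.1.2 q.2)); last exact: hc.
apply/filterlim_locally => eps.
have h1 : locally t (fun s => ball t eps s) by exists eps.
pose proof (proj1 (filterlim_norm_eps _ _ _) (hb t) _ (cond_pos eps)) as h2.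
apply: (filter_imp _ _ _ (filter_and _ _ h1 h2)) => s [hs1 hs2].
split; [split; [split|]|] => /=.
- exact: hs1.
- apply: norm_compat1; rewrite -(linear_minus _ _ _ j_linear).
  exact: Rle_lt_trans (j_norm _) hs2.
- move=> i; apply: norm_compat1; rewrite -(linear_minus _ _ _ (D_linear i)).
  exact: Rle_lt_trans (D_norm i _) hs2.
- exact: ball_center.
Qed.

Lemma mild_solution_extend (S : R -> B -> B) (S1 : R -> B1 -> B1) (a : R) (y : B1)
    (alpha : Bpar) (b : R -> B1) :
  (forall t, 0 <= t -> forall x, j (S1 t x) = S t (j x)) ->
  mild_solution j n D S H a y alpha b ->
  is_mild j S S1 (nonlinearity alpha) a y (fun t => b (Rmax a t)).
Proof.
move=> hS [hb hI]; split; first exact: continuous_on_extend.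
move=> t hat; have [I [hI1 hI2]] := hI t hat.
(* The equation itself shows that the integral lies in [B1], as a difference of two elements of
   [B1]. *)
exists (minus (b t) (S1 (t - a) y)); split; last first.
  by rewrite Rmax_right // /minus plus_comm -plus_assoc plus_opp_l plus_zero_r.
have -> : is_conv j S a t (fun s => nonlinearity alpha s (b (Rmax a s)))
             (minus (b t) (S1 (t - a) y)) =
          is_RInt (fun s => S (t - s) (nonlinearity alpha s (b (Rmax a s)))) a t I.
  rewrite /is_conv (linear_minus _ _ _ j_linear) hS; last lra.
  by rewrite hI2 /minus (plus_comm (S _ _)) -plus_assoc plus_opp_r plus_zero_r.
apply: is_RInt_ext hI1 => s; rewrite Rmin_left // => hs.
by rewrite Rmax_right //; lra.
Qed.

Lemma is_mild_solution (S : R -> B -> B) (S1 : R -> B1 -> B1) (a : R) (y : B1)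
    (alpha : Bpar) (b : R -> B1) :
  (forall t, 0 <= t -> forall x, j (S1 t x) = S t (j x)) ->
  is_mild j S S1 (nonlinearity alpha) a y b -> mild_solution j n D S H a y alpha b.
Proof.
move=> hS [hb hI]; split.
  by move=> t _; apply: filterlim_filter_le_1 (hb t); exact: filter_le_within.
move=> t hat; have [J [hJ ->]] := hI t hat.
exists (j J); split=> //.
by rewrite (linear_plus _ j_linear) hS //; lra.
Qed.

End Nonlinearity.

Lemma ex_lipschitz_constant
    (n : nat) (M m M1 m1 LH LH' LHpar kappa omega tau rho : R)
    (hM : 0 <= M) (hm : 0 <= m) (hM1 : 0 <= M1) (hm1 : 0 <= m1)
    (hkappa : 0 < kappa) (homega : 0 < omega < 1) :
  exists K : R,
  forall (B1 B Bpar : Banach) (j : B1 -> B) (D : 'I_n -> B1 -> B)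
    (S : R -> B -> B) (S1 : R -> B1 -> B1) (H : R -> B -> ('I_n -> B) -> Bpar -> B),
  is_linear j -> injective j -> (forall x, norm (j x) <= norm x) ->
  (forall i, is_linear (D i)) -> (forall i x, norm (D i x) <= norm x) ->
  C0_semigroup S -> C0_semigroup S1 ->
  (forall t, 0 <= t -> forall x, j (S1 t x) = S t (j x)) ->
  (forall t, 0 <= t -> forall x, norm (S t x) <= M * exp (m * t) * norm x) ->
  (forall t, 0 <= t -> forall x, norm (S1 t x) <= M1 * exp (m1 * t) * norm x) ->
  (forall t, 0 < t -> exists St : B -> B1, (forall x, j (St x) = S t x) /\
     (t <= 1 -> forall x, norm (St x) <= kappa * Rpower t (- omega) * norm x)) ->
  assumption_H n H LH LH' LHpar ->
  forall (a r : R) (y y' : B1) (alpha alpha' : Bpar) (b b' : R -> B1),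
  mild_solution j n D S H a y alpha b ->
  mild_solution j n D S H a y' alpha' b' ->
  0 < tau -> norm y <= r -> LH' * r = rho ->
  forall t, a <= t <= a + tau ->
    norm (minus (b t) (b' t)) <=
    K * (norm (minus alpha alpha') * (1 + norm y) + norm (minus y y')).
Proof.
set k := smoothing_const M1 m1 kappa omega tau.
have hk : 0 < k by exact: smoothing_const_gt0.
have hn := pos_INR n.
have mL := Rmax_r LH 0; have mL' := Rmax_r LH' 0; have mrho := Rmax_r rho 0.
have hN : 0 <= Rmax LH 0 * INR n by exact: Rmult_le_pos.
have [e1 e2] := half_inv _ hN.
have [lam1 hw1] := ex_weight k omega tau _ hk homega e1.
set E1 := M1 * exp (m1 * tau).
have hE1 : 0 <= E1 by exact: mult_exp_ge0.
(* A priori growth factor: a solution starting at [y] stays in the ball of radius [c1 * norm y]. *)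
set c1 := 2 * E1 * exp (lam1 * tau).
have hc1 : 0 <= c1 by apply: mult_exp_ge0; lra.
set L := Rmax LH 0 * (1 + INR n).
have hL : 0 <= L by apply: Rmult_le_pos; lra.
have hn1 : 0 <= INR n * c1 by exact: Rmult_le_pos.
(* Lipschitz constant of the nonlinearity on that ball, with [Rmax LH' 0 * norm y] replaced by its
   bound [Rmax rho 0]; the vector [y] is not yet available. *)
have hLam : 0 <= L * (1 + INR n * c1 * Rmax rho 0).
  by apply: Rmult_le_pos => //; have := Rmult_le_pos _ _ hn1 mrho; lra.
have [e3 e4] := half_inv _ hLam; move: e3 e4; set eps := / _ => e3 e4.
have [lam2 hw2] := ex_weight k omega tau _ hk homega e3.
(* The constant of [mild_lipschitz] for [R0 = c1 * norm y], after
   [1 + n c1 |y| <= (1 + n c1) (1 + |y|)]. *)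
exists (2 * (E1 + eps * Rabs LHpar * (1 + INR n * c1)) * exp (lam2 * tau)).
move=> B1 B Bpar j D S S1 H hj hinj hjn hD hDn hS hS1 hSS hSb hS1b hsm hH.
move=> a r y y' alpha alpha' b b' hb hb' htau hyr hr t ht.
have hlam1 : 0 < lam1 by case: hw1.
have hlam2 : 0 < lam2 by case: hw2.
pose F := nonlinearity n j D H.
have hF al : preserves_continuity (F al) by apply: nonlinearity_continuous hH al.
have hmb := mild_solution_extend n j D H hj S S1 a y alpha b hSS hb.
have hmb' := mild_solution_extend n j D H hj S S1 a y' alpha' b' hSS hb'.
have hy := norm_ge_0 y.
have hR s : a <= s <= a + tau -> norm (b (Rmax a s)) <= c1 * norm y.
  move=> hs.
  apply: Rle_trans (mild_bound j S S1 M m M1 m1 kappa omega hM hm hM1 hm1 hkappa homega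
    hj hinj hjn hS hS1 hSS hSb hS1b hsm (F alpha) _ a tau _ lam1 y _ (hF alpha) hN
    (fun s x => nonlinearity_bound n j D H LH LH' LHpar hDn hH alpha s x)
    htau hw1 e2 hmb s hs) _.
  rewrite -/E1 /c1.
  have -> : 2 * E1 * exp (lam1 * tau) * norm y = 2 * (E1 * norm y) * exp (lam1 * tau) by ring.
  apply: Rmult_le_compat_l; first by have := Rmult_le_pos _ _ hE1 hy; lra.
  by apply: exp_le_mono; apply: Rmult_le_compat_l; lra.
have hcy : 0 <= c1 * norm y by exact: Rmult_le_pos.
have hP : 0 <= Rabs LHpar * norm (minus alpha alpha').
  by apply: Rmult_le_pos; [exact: Rabs_pos|exact: norm_ge_0].
have hL'n : 0 <= Rmax LH' 0 * INR n by exact: Rmult_le_pos.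
have hrho : Rmax LH' 0 * norm y <= Rmax rho 0.
  case: (Rle_dec 0 LH') => hL'.
    rewrite (Rmax_left LH') //; apply: Rle_trans (Rmax_l _ _); rewrite -hr.
    exact: Rmult_le_compat_l.
  by rewrite (Rmax_right LH'); lra.
have e5 : eps * (L * (1 + Rmax LH' 0 * INR n * (c1 * norm y))) <= / 2.
  apply: Rle_trans e4; apply: Rmult_le_compat_l; first lra.
  apply: Rmult_le_compat_l => //; have := Rmult_le_compat_l _ _ _ hn1 hrho; lra.
have := mild_lipschitz j S S1 M m M1 m1 kappa omega hM hm hM1 hm1 hkappa homega
    hj hinj hjn hS hS1 hSS hSb hS1b hsm (F alpha) (F alpha') _ L _ (INR n) _ a tau eps lam2
    y y' _ _ (hF alpha) (hF alpha') hP hL hL'n hn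
    (fun s x x' => nonlinearity_lipschitz n j D H LH LH' LHpar hj hjn hD hDn hH alpha alpha' s x x')
    htau hw2 e5 hcy hR hmb hmb' t ht.
rewrite !Rmax_right; try lra; move=> h; apply: Rle_trans h _.
rewrite -/E1.
set dy := norm (minus y y'); set da := norm (minus alpha alpha').
have hdy : 0 <= dy := norm_ge_0 _.
have hda : 0 <= da := norm_ge_0 _.
have hPe : 0 <= eps * Rabs LHpar by apply: Rmult_le_pos; [lra|exact: Rabs_pos].
have hEy : 0 <= E1 * dy by exact: Rmult_le_pos.
have hy1 : 1 + INR n * (c1 * norm y) <= (1 + INR n * c1) * (1 + norm y).
  by have := Rmult_le_pos _ _ hn1 hy; lra.
have hPd : 0 <= eps * Rabs LHpar * da by exact: Rmult_le_pos.
apply: (Rle_trans _ (2 * (E1 * dy + eps * Rabs LHpar * da * ((1 + INR n * c1) * (1 + norm y)))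
    * exp (lam2 * tau))).
  apply: Rmult_le_compat.
  - have : 0 <= eps * (Rabs LHpar * da * (1 + INR n * (c1 * norm y))).
      apply: Rmult_le_pos; first lra; apply: Rmult_le_pos => //.
      by have := Rmult_le_pos _ _ hn hcy; lra.
    lra.
  - by left; exact: exp_pos.
  - by have := Rmult_le_compat_l _ _ _ hPd hy1; lra.
  - by apply: exp_le_mono; apply: Rmult_le_compat_l; lra.
have -> : 2 * (E1 + eps * Rabs LHpar * (1 + INR n * c1)) * exp (lam2 * tau)
    * (da * (1 + norm y) + dy) =
  2 * ((E1 + eps * Rabs LHpar * (1 + INR n * c1)) * (da * (1 + norm y) + dy))
    * exp (lam2 * tau) by ring.
apply: Rmult_le_compat_r; first by left; exact: exp_pos.
apply: Rmult_le_compat_l; first lra.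
have h1 : 0 <= E1 * (da * (1 + norm y)).
  by apply: Rmult_le_pos => //; apply: Rmult_le_pos => //; lra.
have h2 : 0 <= eps * Rabs LHpar * (1 + INR n * c1) * dy.
  by apply: Rmult_le_pos => //; apply: Rmult_le_pos => //; lra.
lra.
Qed.

Theorem theorem4p1
    (n : nat) (M m M1 m1 LH LH' LHpar kappa omega : R)
    (hM : 0 <= M) (hm : 0 <= m) (hM1 : 0 <= M1) (hm1 : 0 <= m1)
    (hkappa : 0 < kappa) (homega : 0 < omega < 1) :
  exists K : R -> R -> R,
  forall (B2 B1 B Bpar : Banach) (j2 : B2 -> B1) (j1 : B1 -> B)
    (D : 'I_n -> B1 -> B) (A : B2 -> B) (S : R -> B -> B)
    (H : R -> B -> ('I_n -> B) -> Bpar -> B),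
  Banach_triple j2 j1 ->
  assumption_D j2 j1 n D ->
  assumption_A j2 j1 A S M m M1 m1 ->
  assumption_H n H LH LH' LHpar ->
  assumption_smoothing j1 S kappa omega ->
  forall a : R,
  (forall (Y : B1) (alpha : Bpar),
     exists b : R -> B1,
       mild_solution j1 n D S H a Y alpha b /\
       forall b' : R -> B1, mild_solution j1 n D S H a Y alpha b' ->
         forall t, a <= t -> b' t = b t) /\
  (forall (Y Y' : B1) (alpha alpha' : Bpar) (b b' : R -> B1) (T r : R),
     mild_solution j1 n D S H a Y alpha b ->
     mild_solution j1 n D S H a Y' alpha' b' ->
     a < T ->
     norm Y <= r ->
     forall t, a <= t <= T ->
       norm (minus (b t) (b' t)) <=
       K (T - a) (LH' * r) *
         (norm (minus alpha alpha') * (1 + norm Y) + norm (minus Y Y'))).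
Proof.
(* Choice turns the separate constants for each [tau] and [rho] into the function [K]. *)
pose cst tau rho := constructive_indefinite_description _
  (ex_lipschitz_constant n M m M1 m1 LH LH' LHpar kappa omega tau rho hM hm hM1 hm1 hkappa homega).
exists (fun tau rho => proj1_sig (cst tau rho)).
move=> B2 B1 B Bpar j2 j D A S H [_ [hj hinj hjn _]] hDa [_ [hS [_ [hSo [S1 [hS1 [hSS [_ hS1o]]]]]]]] hH hsma a.
have hD i : is_linear (D i) by case: (hDa i) => [[]].
have hDn i x : norm (D i x) <= norm x.
  have [[_ h] _] := hDa i; rewrite -(Rmult_1_l (norm x)).
  by apply: opnorm_le h x; exact: linear_scal.
have hSb t : 0 <= t -> forall x, norm (S t x) <= M * exp (m * t) * norm x.
  by move=> ht; apply: opnorm_le (hSo t ht); apply: linear_scal; exact: sg_linear.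
have hS1b t : 0 <= t -> forall x, norm (S1 t x) <= M1 * exp (m1 * t) * norm x.
  by move=> ht; apply: opnorm_le (hS1o t ht); apply: linear_scal; exact: sg_linear.
have hsm t : 0 < t -> exists St : B -> B1, (forall x, j (St x) = S t x) /\
     (t <= 1 -> forall x, norm (St x) <= kappa * Rpower t (- omega) * norm x).
  move=> ht; have [St [h1 h2]] := hsma t ht; exists St; split=> // ht1.
  apply: opnorm_le (h2 ht1) => k x; apply: hinj.
  have ht0 : 0 <= t by lra.
  by rewrite (linear_scal _ hj) !h1 (linear_scal _ (sg_linear _ hS _ ht0)).
have hlip (y y' : B1) (alpha alpha' : Bpar) (b b' : R -> B1) (T r : R) :
     mild_solution j n D S H a y alpha b ->
     mild_solution j n D S H a y' alpha' b' -> a < T -> norm y <= r ->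
     forall t, a <= t <= T ->
       norm (minus (b t) (b' t)) <= proj1_sig (cst (T - a) (LH' * r)) *
         (norm (minus alpha alpha') * (1 + norm y) + norm (minus y y')).
  move=> hb hb' hT hr t ht.
  apply: (proj2_sig (cst (T - a) (LH' * r)) B1 B Bpar j D S S1 H hj hinj hjn hD hDn hS hS1
    hSS hSb hS1b hsm hH a r y y' alpha alpha' b b' hb hb') => //; lra.
split=> // y alpha.
have mL := Rmax_r LH 0; have mL' := Rmax_r LH' 0; have hn := pos_INR n.
have [b hb] : exists b, is_mild j S S1 (nonlinearity n j D H alpha) a y b.
  apply: (ex_mild j S S1 M m M1 m1 kappa omega hM hm hM1 hm1 hkappa homega
    hj hinj hjn hS hS1 hSS hSb hS1b hsm _ (Rmax LH 0 * INR n) (Rmax LH 0 * (1 + INR n))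
    (Rmax LH' 0 * INR n)).
  - exact: nonlinearity_continuous hH alpha.
  - exact: Rmult_le_pos.
  - by apply: Rmult_le_pos; lra.
  - exact: Rmult_le_pos.
  - by move=> s x; apply: (nonlinearity_bound n j D H LH LH' LHpar hDn hH).
  - move=> s x x'.
    apply: Rle_trans (nonlinearity_lipschitz n j D H LH LH' LHpar hj hjn hD hDn hH
      alpha alpha s x x') _.
    by rewrite minus_eq_zero norm_zero; right; ring.
have {}hb := is_mild_solution n j D H hj S S1 a y alpha b hSS hb.
exists b; split=> // b' hb' t hat.
apply: eq_of_small_dist => eps he.
have hT : a < t + 1 by lra.
have ht : a <= t <= t + 1 by lra.
(* Uniqueness is the Lipschitz estimate with equal data, whose right-hand side vanishes. *)
apply: Rle_trans (hlip y y alpha alpha b' b (t + 1) (norm y) hb' hb hT (Rle_refl _) t ht) _.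
by rewrite !minus_eq_zero !norm_zero; lra.
Qed.
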